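(* Let $\Omega\subset\mathbb{C}$ be a bounded simply-connected domain, let $\psi:\mathbb{D}\to\Omega$ be a Riemann map (a biholomorphism from the open unit disc $\mathbb{D}$ onto $\Omega$), and let $o=\psi(0)$. Then the following are equivalent: (i) for every $x\in\partial\Omega$ and every $R>0$, $\overline{H^s_o(x,R)}\cap\partial\Omega=\overline{H^b_o(x,R)}\cap\partial\Omega=\{x\}$; (ii) $\psi$ extends to a homeomorphism from $\overline{\mathbb{D}}$ onto $\overline{\Omega}$, i.e. $\Omega$ is a Jordan domain.
   Context: For a Kobayashi hyperbolic domain $\Omega\subset\mathbb{C}^d$ with Kobayashi distance $\mathsf{k}_\Omega$, a point $x\in\partial\Omega$ (boundary in $\mathbb{C}^d$), a pole $o\in\Omega$ and $R>0$, the small horosphere and big horosphere are $H^s_o(x,R)=\{z\in\Omega:\limsup_{w\to x}(\mathsf{k}_\Omega(z,w)-\mathsf{k}_\Omega(o,w))<\tfrac12\log R\}$, $H^b_o(x,R)=\{z\in\Omega:\liminf_{w\to x}(\mathsf{k}_\Omega(z,w)-\mathsf{k}_\Omega(o,w))<\tfrac12\log R\}$, where $w$ ranges over $\Omega$. Closures are taken in $\mathbb{C}^d$. *)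

(* Defs.v *)
From Stdlib Require Import Reals Lra.
From Coquelicot Require Import Coquelicot.
Open Scope R_scope.

Definition cset := C -> Prop.

Definition cdist (z w : C) : R := Cmod (Cminus z w).

Definition unit_disc : cset := fun z => Cmod z < 1.
Definition closed_unit_disc : cset := fun z => Cmod z <= 1.

Definition c_open (U : cset) : Prop :=
  forall z, U z -> exists r, 0 < r /\ forall w, cdist w z < r -> U w.

Definition c_connected (S : cset) : Prop :=
  ~ (exists U V : cset, c_open U /\ c_open V /\
       (forall z, S z -> U z \/ V z) /\
       (exists z, S z /\ U z) /\ (exists z, S z /\ V z) /\
       (forall z, S z -> U z -> V z -> False)).

Definition c_domain (S : cset) : Prop :=
  (exists z, S z) /\ c_open S /\ c_connected S.

Definition c_bounded (S : cset) : Prop :=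
  exists M, forall z, S z -> Cmod z <= M.

Definition c_closure (S : cset) : cset :=
  fun x => forall r, 0 < r -> exists y, S y /\ cdist y x < r.
Definition c_boundary (S : cset) : cset :=
  fun x => c_closure S x /\ ~ S x.

Definition c_continuous_on (A : cset) (f : C -> C) : Prop :=
  forall z, A z -> forall eps, 0 < eps -> exists delta, 0 < delta /\
    forall w, A w -> cdist w z < delta -> cdist (f w) (f z) < eps.

Definition c_homeomorphism (A B : cset) (F : C -> C) : Prop :=
  exists G : C -> C,
    (forall z, A z -> B (F z)) /\ (forall w, B w -> A (G w)) /\
    (forall z, A z -> G (F z) = z) /\ (forall w, B w -> F (G w) = w) /\
    c_continuous_on A F /\ c_continuous_on B G.

Definition unit_interval (t : R) : Prop := 0 <= t <= 1.

Definition loop_in (S : cset) (g : R -> C) : Prop :=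
  (forall t, unit_interval t -> S (g t)) /\ g 0 = g 1 /\
  (forall t, unit_interval t -> forall eps, 0 < eps -> exists delta, 0 < delta /\
     forall t', unit_interval t' -> Rabs (t' - t) < delta ->
       cdist (g t') (g t) < eps).

Definition null_homotopic_in (S : cset) (g : R -> C) : Prop :=
  exists (H : R -> R -> C) (c : C),
    (forall s t, unit_interval s -> unit_interval t -> S (H s t)) /\
    (forall t, unit_interval t -> H 0 t = g t) /\
    (forall t, unit_interval t -> H 1 t = c) /\
    (forall s, unit_interval s -> H s 0 = H s 1) /\
    (forall s t, unit_interval s -> unit_interval t ->
       forall eps, 0 < eps -> exists delta, 0 < delta /\
       forall s' t', unit_interval s' -> unit_interval t' ->
         Rabs (s' - s) < delta -> Rabs (t' - t) < delta ->
         cdist (H s' t') (H s t) < eps).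

Definition c_simply_connected (S : cset) : Prop :=
  c_domain S /\ forall g, loop_in S g -> null_homotopic_in S g.

Definition c_differentiable_at (f : C -> C) (z : C) : Prop :=
  exists l : C, forall eps, 0 < eps -> exists delta, 0 < delta /\
    forall h : C, 0 < Cmod h < delta ->
      cdist (Cdiv (Cminus (f (Cplus z h)) (f z)) h) l < eps.

Definition holomorphic_on (U : cset) (f : C -> C) : Prop :=
  forall z, U z -> c_differentiable_at f z.

(* biholomorphism of U onto V (the inverse of a bijective holomorphic map is
   automatically holomorphic; we nevertheless require it explicitly) *)
Definition biholomorphism (U V : cset) (f : C -> C) : Prop :=
  holomorphic_on U f /\
  (forall z, U z -> V (f z)) /\
  (forall z1 z2, U z1 -> U z2 -> f z1 = f z2 -> z1 = z2) /\
  (exists g : C -> C, holomorphic_on V g /\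
     (forall w, V w -> U (g w) /\ f (g w) = w)).

(* Poincare distance on the unit disc, normalised so that
   rho(0,z) = (1/2) log ((1+|z|)/(1-|z|)) *)
Definition poincare (a b : C) : R :=
  let t := Cmod (Cminus a b) / Cmod (Cminus (RtoC 1) (Cmult (Cconj a) b)) in
  / 2 * ln ((1 + t) / (1 - t)).

Fixpoint sumR (n : nat) (u : nat -> R) : R :=
  match n with O => 0 | S m => sumR m u + u m end.

Definition kob_chain_length (Omega : cset) (z w : C) (s : R) : Prop :=
  exists (n : nat) (p : nat -> C) (f : nat -> C -> C) (a b : nat -> C),
    p O = z /\ p n = w /\
    (forall j, (j < n)%nat ->
       holomorphic_on unit_disc (f j) /\
       (forall u, unit_disc u -> Omega (f j u)) /\
       unit_disc (a j) /\ unit_disc (b j) /\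
       f j (a j) = p j /\ f j (b j) = p (S j)) /\
    s = sumR n (fun j => poincare (a j) (b j)).

Definition kobayashi (Omega : cset) (z w : C) : R :=
  real (Glb_Rbar (kob_chain_length Omega z w)).

Definition limsup_lt (Omega : cset) (x : C) (g : C -> R) (c : R) : Prop :=
  exists delta c', 0 < delta /\ c' < c /\
    forall w, Omega w -> cdist w x < delta -> g w <= c'.

Definition liminf_lt (Omega : cset) (x : C) (g : C -> R) (c : R) : Prop :=
  exists c', c' < c /\ forall delta, 0 < delta ->
    exists w, Omega w /\ cdist w x < delta /\ g w <= c'.

Definition small_horosphere (Omega : cset) (o x : C) (Rr : R) : cset :=
  fun z => Omega z /\
    limsup_lt Omega x (fun w => kobayashi Omega z w - kobayashi Omega o w)
      (/ 2 * ln Rr).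

Definition big_horosphere (Omega : cset) (o x : C) (Rr : R) : cset :=
  fun z => Omega z /\
    liminf_lt Omega x (fun w => kobayashi Omega z w - kobayashi Omega o w)
      (/ 2 * ln Rr).

(* Main.v *)
(* The Riemann map carries the Kobayashi distance to the Poincare distance, by the
   Schwarz-Pick lemma, and for [|w| -> 1]
     exp (2 (rho(z,w) - rho(0,w))) ~ |z - w|^2 / (1 - |z|^2).
   Hence the small horosphere at [x] lies in the intersection of the closed horodiscs
   [|z - s|^2 <= R (1 - |z|^2)], [s] ranging over the cluster points of [psi^-1] at
   [x].  If it is nonempty for every [R], there is only one such [s], so [psi^-1]
   extends continuously to the boundary, and then both horospheres at [x] are the
   image of the open horodisc at [s].  Two boundary points with the same [s] have
   the same horospheres, so (i) forces the extension to be injective; compactness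
   makes it a homeomorphism. *)
Require Import Defs.
From Stdlib Require Import Reals Lra Lia Psatz Classical ClassicalEpsilon.
From Coquelicot Require Import Coquelicot.
Open Scope R_scope.

(** * Goursat's theorem on a rectangle *)

(** Holomorphy means here only that a derivative exists at each point, with no continuity of the
    derivative, so Schwarz-Pick has to start from Goursat's subdivision argument. In logarithmic
    coordinates that argument yields the mean value property for a function differentiable on a
    punctured disc and merely continuous at its centre, which is exactly the situation of [f z / z]
    in the Schwarz lemma. The asymptotic relation for the difference of distances comes from an
    exact formula, [poincare_sub]. The lower bound drawn from it holds for every [w], the upper
    bound uniformly for [w] near [s], with the strict gap that [limsup_lt] and [liminf_lt] ask for.
    A horodisc of parameter R lies within sqrt R of its base point. A point common to the horodiscs
    at two cluster points therefore bounds their distance by 2 sqrt R, which is why arbitrarily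
    small R leave a single cluster point. Boundedness of [Omega] makes every point of the circle a
    cluster point at some boundary point, so that the extension of [psi] is defined on the whole
    circle. *)

Lemma nested_intervals (a b : nat -> R) :
  (forall n, a n <= a (S n)) -> (forall n, b (S n) <= b n) ->
  (forall n, a n <= b n) -> exists x, forall n, a n <= x <= b n.
Proof.
  intros Ha Hb Hab.
  assert (Ha' : forall n m, (n <= m)%nat -> a n <= a m).
  { induction 1; [lra|]. specialize (Ha m). lra. }
  assert (Hb' : forall n m, (n <= m)%nat -> b m <= b n).
  { induction 1; [lra|]. specialize (Hb m). lra. }
  assert (Hm : forall n m, a n <= b m).
  { intros n m. specialize (Ha' n (max n m) ltac:(lia)).
    specialize (Hb' m (max n m) ltac:(lia)). specialize (Hab (max n m)). lra. }
  destruct (completeness (fun r => exists n, r = a n)) as [x [Hx1 Hx2]].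
  - exists (b O). intros r [n ->]. apply Hm.
  - exists (a O). now exists O.
  - exists x. intros n. split.
    + apply Hx1. now exists n.
    + apply Hx2. intros r [m ->]. apply Hm.
Qed.

(** The small rectangle is recorded as a copy of the original scaled by [t]: Goursat's estimate
    compares area with perimeter times diameter, and both scale like [t ^ 2]. *)
Lemma rectangle_bisection (P : R -> R -> R -> R -> Prop) (a b c d : R) :
  a <= b -> c <= d -> P a b c d ->
  (forall a b c d, a <= b -> c <= d -> P a b c d ->
     let m := (a + b) / 2 in let n := (c + d) / 2 in
     P a m c n \/ P m b c n \/ P a m n d \/ P m b n d) ->
  exists x y, a <= x <= b /\ c <= y <= d /\ forall delta, 0 < delta ->
    exists a' b' c' d' t, 0 < t < delta /\
      b' - a' = (b - a) * t /\ d' - c' = (d - c) * t /\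
      a' <= x <= b' /\ c' <= y <= d' /\ P a' b' c' d'.
Proof.
  intros Hab Hcd HP Hstep.
  pose (good := fun r : (R * R) * (R * R) =>
    fst (fst r) <= snd (fst r) /\ fst (snd r) <= snd (snd r) /\
    P (fst (fst r)) (snd (fst r)) (fst (snd r)) (snd (snd r))).
  pose (half := fun i j : R * R => fst i <= fst j /\ snd j <= snd i /\
    snd j - fst j = (snd i - fst i) / 2).
  (* The premise [good r] sits under the existential so that choice produces a total function
     [next]; on a bad rectangle the witness is a dummy. *)
  assert (S0 : forall r, exists r', good r ->
            good r' /\ half (fst r) (fst r') /\ half (snd r) (snd r')).
  { intros [[p q] [s t]]. destruct (classic (good ((p, q), (s, t)))) as [G|G].
    2:{ exists ((p, q), (s, t)). tauto. }
    destruct G as [G1 [G2 G3]]; simpl in *.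
    destruct (Hstep p q s t G1 G2 G3) as [H|[H|[H|H]]].
    - exists ((p, (p + q) / 2), (s, (s + t) / 2)). unfold good, half; simpl.
      intros _. repeat split; try assumption; lra.
    - exists (((p + q) / 2, q), (s, (s + t) / 2)). unfold good, half; simpl.
      intros _. repeat split; try assumption; lra.
    - exists ((p, (p + q) / 2), ((s + t) / 2, t)). unfold good, half; simpl.
      intros _. repeat split; try assumption; lra.
    - exists (((p + q) / 2, q), ((s + t) / 2, t)). unfold good, half; simpl.
      intros _. repeat split; try assumption; lra. }
  pose (next := fun r => proj1_sig (constructive_indefinite_description _ (S0 r))).
  assert (Hnext : forall r, good r -> good (next r) /\
            half (fst r) (fst (next r)) /\ half (snd r) (snd (next r))).
  { intros r. unfold next.
    exact (proj2_sig (constructive_indefinite_description _ (S0 r))). }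
  pose (s := fun n => Nat.iter n next ((a, b), (c, d))).
  assert (Hgood : forall n, good (s n)).
  { induction n; [repeat split; assumption|]. now apply Hnext. }
  assert (Hhalf : forall n, half (fst (s n)) (fst (s (S n))) /\
                            half (snd (s n)) (snd (s (S n)))).
  { intros n. exact (proj2 (Hnext _ (Hgood n))). }
  assert (Hw : forall n,
     snd (fst (s n)) - fst (fst (s n)) = (b - a) * (/ 2) ^ n /\
     snd (snd (s n)) - fst (snd (s n)) = (d - c) * (/ 2) ^ n).
  { induction n.
    - simpl; lra.
    - destruct (Hhalf n) as [[_ [_ H1]] [_ [_ H2]]]. rewrite H1, H2.
      destruct IHn as [-> ->]. simpl. lra. }
  destruct (nested_intervals (fun n => fst (fst (s n))) (fun n => snd (fst (s n))))
    as [x Hx].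
  1,2: intros n; apply (Hhalf n).
  { intros n; apply (Hgood n). }
  destruct (nested_intervals (fun n => fst (snd (s n))) (fun n => snd (snd (s n))))
    as [y Hy].
  1,2: intros n; apply (Hhalf n).
  { intros n; apply (Hgood n). }
  exists x, y. split; [exact (Hx O)|]. split; [exact (Hy O)|].
  intros delta Hd.
  destruct (pow_lt_1_zero (/ 2) ltac:(rewrite Rabs_pos_eq; lra) delta Hd) as [N HN].
  specialize (HN N (le_n _)). rewrite Rabs_pos_eq in HN by (apply pow_le; lra).
  exists (fst (fst (s N))), (snd (fst (s N))), (fst (snd (s N))), (snd (snd (s N))),
    ((/ 2) ^ N).
  repeat split; try apply Hw; try apply Hx; try apply Hy; try assumption.
  - apply pow_lt; lra.
  - apply Hgood.
Qed.

(** Complex differentiability of [u + i v] with derivative [p + i q]. The Cauchy-Riemann equations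
    are built in through the shared coefficients, and the l1 error suits estimates side by side on a
    rectangle. *)
Definition cr_approx (u v : R -> R -> R) (x0 y0 : R) : Prop :=
  exists p q, forall eta, 0 < eta -> exists delta, 0 < delta /\
    forall x y, Rabs (x - x0) < delta -> Rabs (y - y0) < delta ->
      Rabs (u x y - (u x0 y0 + p * (x - x0) - q * (y - y0)))
        <= eta * (Rabs (x - x0) + Rabs (y - y0)) /\
      Rabs (v x y - (v x0 y0 + q * (x - x0) + p * (y - y0)))
        <= eta * (Rabs (x - x0) + Rabs (y - y0)).

(* The imaginary part of the integral of [u + i v] along the boundary. *)
Definition im_boundary (u v : R -> R -> R) (a b c d : R) : R :=
  RInt (fun x => v x c) a b - RInt (fun x => v x d) a b
  + RInt (fun y => u b y) c d - RInt (fun y => u a y) c d.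

Lemma continuous_eps (f : R -> R) (x : R) :
  (forall eps, 0 < eps -> exists delta, 0 < delta /\
     forall y, Rabs (y - x) < delta -> Rabs (f y - f x) < eps) ->
  continuous f x.
Proof.
  intros H. apply filterlim_locally. intros eps.
  destruct (H eps (cond_pos eps)) as [d [Hd H']].
  exists (mkposreal d Hd). intros y Hy. exact (H' y Hy).
Qed.

Lemma cr_approx_continuous (u v : R -> R -> R) (x0 y0 : R) :
  cr_approx u v x0 y0 -> forall eps, 0 < eps -> exists delta, 0 < delta /\
    forall x y, Rabs (x - x0) < delta -> Rabs (y - y0) < delta ->
      Rabs (u x y - u x0 y0) < eps /\ Rabs (v x y - v x0 y0) < eps.
Proof.
  intros [p [q H]] eps Heps. destruct (H 1 Rlt_0_1) as [d [Hd H']].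
  pose (M := 1 + Rabs p + Rabs q).
  assert (HM : 0 < M) by (unfold M; generalize (Rabs_pos p) (Rabs_pos q); lra).
  exists (Rmin d (eps / (4 * M))). split.
  { apply Rmin_pos; [lra|]. apply Rdiv_lt_0_compat; lra. }
  intros x y Hx Hy.
  destruct (H' x y) as [H1 H2].
  { eapply Rlt_le_trans; [exact Hx|apply Rmin_l]. }
  { eapply Rlt_le_trans; [exact Hy|apply Rmin_l]. }
  assert (Hx' : Rabs (x - x0) < eps / (4 * M))
    by (eapply Rlt_le_trans; [exact Hx|apply Rmin_r]).
  assert (Hy' : Rabs (y - y0) < eps / (4 * M))
    by (eapply Rlt_le_trans; [exact Hy|apply Rmin_r]).
  assert (Hs : (Rabs (x - x0) + Rabs (y - y0)) * M < eps).
  { apply Rle_lt_trans with (2 * (eps / (4 * M)) * M).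
    - apply Rmult_le_compat_r; lra.
    - field_simplify; lra. }
  generalize (Rabs_pos (x - x0)) (Rabs_pos (y - y0)) (Rabs_pos p) (Rabs_pos q).
  intros P1 P2 P3 P4. unfold M in Hs. split.
  - replace (u x y - u x0 y0) with
      ((u x y - (u x0 y0 + p * (x - x0) - q * (y - y0))) + (p * (x - x0) + - (q * (y - y0)))) by ring.
    eapply Rle_lt_trans; [apply Rabs_triang|].
    generalize (Rabs_triang (p * (x - x0)) (- (q * (y - y0)))).
    rewrite Rabs_Ropp, !Rabs_mult. nra.
  - replace (v x y - v x0 y0) with
      ((v x y - (v x0 y0 + q * (x - x0) + p * (y - y0))) + (q * (x - x0) + p * (y - y0))) by ring.
    eapply Rle_lt_trans; [apply Rabs_triang|].
    generalize (Rabs_triang (q * (x - x0)) (p * (y - y0))).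
    rewrite !Rabs_mult. nra.
Qed.

Lemma RInt_near_affine (f : R -> R) (a b al be M : R) :
  a <= b -> ex_RInt f a b ->
  (forall x, a <= x <= b -> Rabs (f x - (al + be * x)) <= M) ->
  Rabs (RInt f a b - (al * (b - a) + be * (b ^ 2 - a ^ 2) / 2)) <= (b - a) * M.
Proof.
  intros Hab Hf HM.
  assert (Hg : is_RInt (fun x => al + be * x) a b
                 (al * (b - a) + be * (b ^ 2 - a ^ 2) / 2)).
  { replace (al * (b - a) + be * (b ^ 2 - a ^ 2) / 2) with
      (minus (al * b + be * b ^ 2 / 2) (al * a + be * a ^ 2 / 2))
      by (unfold minus, plus, opp; simpl; field).
    apply (is_RInt_derive (fun x => al * x + be * x ^ 2 / 2)).
    - intros x _. auto_derive; [trivial|]. field.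
    - intros x _. apply (ex_derive_continuous (fun x => al + be * x)).
      auto_derive. trivial. }
  rewrite <- (is_RInt_unique _ _ _ _ Hg).
  assert (E := RInt_minus (V := R_CompleteNormedModule) f (fun x => al + be * x) a b
    Hf (ex_intro _ _ Hg)).
  change (minus ?r ?s) with (r - s) in E. rewrite <- E.
  apply abs_RInt_le_const; [assumption| |exact HM].
  apply (ex_RInt_minus (V := R_NormedModule)); [assumption|exact (ex_intro _ _ Hg)].
Qed.

(** The affine parts contribute nothing: opposite sides cancel because [u] and [v] share [p] and [q]
    as in the Cauchy-Riemann equations. Only the error remains, at most [M] times the perimeter. *)
Lemma im_boundary_local (u v : R -> R -> R) (a b c d x0 y0 p q M : R) :
  a <= b -> c <= d ->
  ex_RInt (fun x => v x c) a b -> ex_RInt (fun x => v x d) a b ->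
  ex_RInt (fun y => u b y) c d -> ex_RInt (fun y => u a y) c d ->
  (forall x y, a <= x <= b -> c <= y <= d ->
     Rabs (u x y - (u x0 y0 + p * (x - x0) - q * (y - y0))) <= M /\
     Rabs (v x y - (v x0 y0 + q * (x - x0) + p * (y - y0))) <= M) ->
  Rabs (im_boundary u v a b c d) <= 2 * ((b - a) + (d - c)) * M.
Proof.
  intros Hab Hcd E1 E2 E3 E4 H. unfold im_boundary.
  assert (B1 := RInt_near_affine _ a b (v x0 y0 - q * x0 + p * (c - y0)) q M Hab E1).
  assert (B2 := RInt_near_affine _ a b (v x0 y0 - q * x0 + p * (d - y0)) q M Hab E2).
  assert (B3 := RInt_near_affine _ c d (u x0 y0 + p * (b - x0) + q * y0) (- q) M Hcd E3).
  assert (B4 := RInt_near_affine _ c d (u x0 y0 + p * (a - x0) + q * y0) (- q) M Hcd E4).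
  cbv beta in *.
  apply Rabs_le_between in B1; [|intros x Hx; destruct (H x c) as [_ K]; try lra;
    replace (v x0 y0 - q * x0 + p * (c - y0) + q * x) with
      (v x0 y0 + q * (x - x0) + p * (c - y0)) by ring; exact K].
  apply Rabs_le_between in B2; [|intros x Hx; destruct (H x d) as [_ K]; try lra;
    replace (v x0 y0 - q * x0 + p * (d - y0) + q * x) with
      (v x0 y0 + q * (x - x0) + p * (d - y0)) by ring; exact K].
  apply Rabs_le_between in B3; [|intros y Hy; destruct (H b y) as [K _]; try lra;
    replace (u x0 y0 + p * (b - x0) + q * y0 + - q * y) with
      (u x0 y0 + p * (b - x0) - q * (y - y0)) by ring; exact K].
  apply Rabs_le_between in B4; [|intros y Hy; destruct (H a y) as [K _]; try lra;
    replace (u x0 y0 + p * (a - x0) + q * y0 + - q * y) with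
      (u x0 y0 + p * (a - x0) - q * (y - y0)) by ring; exact K].
  apply Rabs_le_between. lra.
Qed.

Lemma RInt_split (f : R -> R) (a m b : R) :
  ex_RInt f a b -> a <= m <= b -> RInt f a b = RInt f a m + RInt f m b.
Proof.
  intros Hf Hm. symmetry.
  apply (RInt_Chasles (V := R_CompleteNormedModule) f).
  - apply (ex_RInt_Chasles_1 (V := R_CompleteNormedModule) f a _ b); assumption.
  - apply (ex_RInt_Chasles_2 (V := R_CompleteNormedModule) f a _ b); assumption.
Qed.

(* Goursat's argument: an excess of the boundary integral over a fixed multiple
   of the area is inherited by one quarter, whereas near a point of
   differentiability the integral is small compared to the area. *)
Lemma goursat_rectangle (u v : R -> R -> R) (a b c d : R) :
  a <= b -> c <= d ->
  (forall x y, a <= x <= b -> c <= y <= d -> cr_approx u v x y) ->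
  im_boundary u v a b c d = 0.
Proof.
  intros Hab Hcd Hcr.
  assert (Iv : forall a' b' y, a <= a' -> a' <= b' -> b' <= b -> c <= y <= d ->
                 ex_RInt (fun x => v x y) a' b').
  { intros a' b' y H1 H2 H3 H4. apply (ex_RInt_continuous (V := R_CompleteNormedModule)).
    intros x Hx. rewrite Rmin_left, Rmax_right in Hx by lra.
    apply continuous_eps. intros eps Heps.
    destruct (cr_approx_continuous u v x y (Hcr x y ltac:(lra) H4) eps Heps) as [dl [Hdl K]].
    exists dl; split; [assumption|]. intros x' Hx'. apply K; [assumption|].
    replace (y - y) with 0 by ring. now rewrite Rabs_R0. }
  assert (Iu : forall c' d' x, c <= c' -> c' <= d' -> d' <= d -> a <= x <= b ->
                 ex_RInt (fun y => u x y) c' d').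
  { intros c' d' x H1 H2 H3 H4. apply (ex_RInt_continuous (V := R_CompleteNormedModule)).
    intros y Hy. rewrite Rmin_left, Rmax_right in Hy by lra.
    apply continuous_eps. intros eps Heps.
    destruct (cr_approx_continuous u v x y (Hcr x y H4 ltac:(lra)) eps Heps) as [dl [Hdl K]].
    exists dl; split; [assumption|]. intros y' Hy'. apply K; [|assumption].
    replace (x - x) with 0 by ring. now rewrite Rabs_R0. }
  (* Degenerate rectangles are settled first, since the rest divides by the area. *)
  destruct (Req_dec a b) as [<-|Hab'].
  { unfold im_boundary. rewrite !RInt_point. unfold zero; simpl. lra. }
  destruct (Req_dec c d) as [<-|Hcd'].
  { unfold im_boundary. rewrite !RInt_point. unfold zero; simpl. lra. }
  apply NNPP. intros HK. apply Rabs_pos_lt in HK.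
  pose (A := (b - a) * (d - c)).
  assert (HA : 0 < A) by (apply Rmult_lt_0_compat; lra).
  pose (e := Rabs (im_boundary u v a b c d) / A).
  assert (He : 0 < e) by now apply Rdiv_lt_0_compat.
  destruct (rectangle_bisection (fun a' b' c' d' =>
     a <= a' /\ b' <= b /\ c <= c' /\ d' <= d /\
     e * ((b' - a') * (d' - c')) <= Rabs (im_boundary u v a' b' c' d'))
     a b c d Hab Hcd) as [x [y [Hx [Hy Hxy]]]].
  { repeat split; try lra. unfold e. fold A. right. field. lra. }
  { intros a' b' c' d' Hab2 Hcd2 [H1 [H2 [H3 [H4 H5]]]] m n.
    assert (Hm : a' <= m <= b') by (unfold m; lra).
    assert (Hn : c' <= n <= d') by (unfold n; lra).
    clearbody m n.
    assert (Hsum : im_boundary u v a' b' c' d' =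
       im_boundary u v a' m c' n + im_boundary u v m b' c' n +
       im_boundary u v a' m n d' + im_boundary u v m b' n d').
    { unfold im_boundary.
      assert (S1 := RInt_split (fun x => v x c') a' m b' ltac:(apply Iv; lra) Hm).
      assert (S2 := RInt_split (fun x => v x d') a' m b' ltac:(apply Iv; lra) Hm).
      assert (S3 := RInt_split (fun y => u a' y) c' n d' ltac:(apply Iu; lra) Hn).
      assert (S4 := RInt_split (fun y => u b' y) c' n d' ltac:(apply Iu; lra) Hn).
      lra. }
    assert (Har : (b' - a') * (d' - c') = (m - a') * (n - c') + (b' - m) * (n - c') +
       (m - a') * (d' - n) + (b' - m) * (d' - n)) by ring.
    rewrite Hsum, Har in H5.
    match type of H5 with _ <= Rabs (?p + ?q + ?r + ?s) =>
      assert (T : Rabs (p + q + r + s) <= Rabs p + Rabs q + Rabs r + Rabs s)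
        by (generalize (Rabs_triang (p + q + r) s) (Rabs_triang (p + q) r)
              (Rabs_triang p q); lra);
      destruct (Rle_dec (e * ((m - a') * (n - c'))) (Rabs p)) as [K|K];
      [left; repeat split; lra|];
      destruct (Rle_dec (e * ((b' - m) * (n - c'))) (Rabs q)) as [K'|K'];
      [right; left; repeat split; lra|];
      destruct (Rle_dec (e * ((m - a') * (d' - n))) (Rabs r)) as [K2|K2];
      [right; right; left; repeat split; lra|];
      right; right; right; repeat split; lra
    end. }
  destruct (Hcr x y Hx Hy) as [p [q Hpq]].
  pose (L := (b - a) + (d - c)).
  assert (HL : 0 < L) by (unfold L; lra).
  (* At scale [t] the perimeter is [2 * L * t] and the error at most this constant times [t * L].
     The product is [e * A * t ^ 2 / 2], half of the inherited lower bound. *)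
  destruct (Hpq (e * A / (4 * L ^ 2))) as [dl [Hdl K]].
  { apply Rdiv_lt_0_compat; nra. }
  destruct (Hxy (dl / L)) as [a' [b' [c' [d' [t [Ht [W1 [W2 [Hx' [Hy' [H1 [H2 [H3 [H4 H5]]]]]]]]]]]]]].
  { now apply Rdiv_lt_0_compat. }
  assert (HtL : t * L < dl).
  { apply Rlt_le_trans with (dl / L * L); [apply Rmult_lt_compat_r; lra|right; field; lra]. }
  assert (Hloc : Rabs (im_boundary u v a' b' c' d')
     <= 2 * ((b' - a') + (d' - c')) * (e * A / (4 * L ^ 2) * (t * L))).
  { apply (im_boundary_local u v a' b' c' d' x y p q); [lra|lra| | | | |].
    1,2: apply Iv; lra.
    1,2: apply Iu; lra.
    intros x' y' Hx2 Hy2.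
    assert (X1 : Rabs (x' - x) <= b' - a') by (apply Rabs_le_between; lra).
    assert (X2 : Rabs (y' - y) <= d' - c') by (apply Rabs_le_between; lra).
    assert (X3 : Rabs (x' - x) + Rabs (y' - y) <= t * L) by (unfold L; lra).
    destruct (K x' y') as [K1 K2].
    - generalize (Rabs_pos (y' - y)); lra.
    - generalize (Rabs_pos (x' - x)); lra.
    - assert (0 <= e * A / (4 * L ^ 2)) by (apply Rlt_le, Rdiv_lt_0_compat; nra).
      split; (eapply Rle_trans; [eassumption|]); now apply Rmult_le_compat_l. }
  rewrite W1, W2 in Hloc, H5.
  replace (2 * ((b - a) * t + (d - c) * t) * (e * A / (4 * L ^ 2) * (t * L)))
    with (e * (A * t ^ 2) / 2) in Hloc by (unfold L in *; field; lra).
  replace ((b - a) * t * ((d - c) * t)) with (A * t ^ 2) in H5 by (unfold A; ring).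
  assert (0 < e * (A * t ^ 2)).
  { apply Rmult_lt_0_compat; [assumption|]. apply Rmult_lt_0_compat; [assumption|].
    apply pow_lt; lra. }
  lra.
Qed.

(** * Compactness in the plane *)

Lemma Cmod_le_abs (x y : R) : Cmod (x, y) <= Rabs x + Rabs y.
Proof.
  unfold Cmod; simpl fst; simpl snd.
  rewrite <- (sqrt_pow2 (Rabs x + Rabs y)) by (generalize (Rabs_pos x) (Rabs_pos y); lra).
  apply sqrt_le_1_alt. rewrite <- (pow2_abs x), <- (pow2_abs y).
  generalize (Rabs_pos x) (Rabs_pos y); nra.
Qed.

Lemma abs_fst_le_Cmod (z : C) : Rabs (fst z) <= Cmod z.
Proof. eapply Rle_trans; [apply Rmax_l|apply Rmax_Cmod]. Qed.

Lemma abs_snd_le_Cmod (z : C) : Rabs (snd z) <= Cmod z.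
Proof. eapply Rle_trans; [apply Rmax_r|apply Rmax_Cmod]. Qed.

Lemma cdist_sym (z w : C) : cdist z w = cdist w z.
Proof. unfold cdist. rewrite <- Cmod_opp. f_equal. ring. Qed.

Lemma cdist_triangle (x y z : C) : cdist x z <= cdist x y + cdist y z.
Proof.
  unfold cdist. replace (x - z)%C with ((x - y) + (y - z))%C by ring.
  apply Cmod_triangle.
Qed.

Lemma cdist_refl (z : C) : cdist z z = 0.
Proof. unfold cdist. replace (z - z)%C with (RtoC 0) by ring. apply Cmod_0. Qed.

Lemma cdist_eq_0 (z w : C) : cdist z w <= 0 -> z = w.
Proof.
  intros H. assert (E : (z - w)%C = 0).
  { apply Cmod_eq_0. apply Rle_antisym; [exact H|apply Cmod_ge_0]. }
  replace z with ((z - w) + w)%C by ring. rewrite E. ring.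
Qed.

Lemma Cmod_triangle_inv (z w : C) : Cmod z <= Cmod w + cdist z w.
Proof.
  unfold cdist. replace z with (w + (z - w))%C at 1 by ring. apply Cmod_triangle.
Qed.

(** Bolzano-Weierstrass for conditions that vary with [n], without choosing a sequence. If it fails,
    each point has a gauge bounding both a square and the indices that can occur in it; compactness
    bounds the gauge below, and a large index contradicts this. *)
Lemma accumulation_point (P : nat -> C -> Prop) (M : R) :
  (forall n, exists z, P n z /\ Cmod z <= M) ->
  exists z0, forall eps, 0 < eps -> forall N, exists n z,
    (N <= n)%nat /\ P n z /\ cdist z z0 < eps.
Proof.
  intros HP. apply NNPP. intros Hno.
  assert (Hd : forall x y : R, exists d : posreal, forall n z, / d < INR n -> P n z ->
     Rabs (fst z - x) < d -> Rabs (snd z - y) < d -> False).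
  { intros x y. apply NNPP. intros H. apply Hno. exists (x, y).
    intros eps Heps N. apply NNPP. intros H'. apply H.
    pose (rho := Rmin (eps / 2) (/ INR (S N))).
    assert (Hpos : 0 < rho).
    { apply Rmin_pos; [lra|]. apply Rinv_0_lt_compat, lt_0_INR. lia. }
    exists (mkposreal rho Hpos). simpl pos. intros n z Hn Pz Hx Hy. apply H'.
    exists n, z. split; [|split; [assumption|]].
    - apply Nat.lt_le_incl, INR_lt. eapply Rle_lt_trans; [|exact Hn].
      apply Rle_trans with (INR (S N)); [apply le_INR; lia|].
      rewrite <- (Rinv_inv (INR (S N))) at 1.
      apply Rinv_le_contravar; [assumption|apply Rmin_r].
    - destruct z as [z1 z2]. simpl fst in Hx. simpl snd in Hy.
      change (Cmod (z1 - x, z2 - y) < eps).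
      eapply Rle_lt_trans; [apply Cmod_le_abs|].
      assert (K := Rmin_l (eps / 2) (/ INR (S N))). unfold rho in *. lra. }
  pose (d := fun x y => proj1_sig (constructive_indefinite_description _ (Hd x y))).
  assert (Hd' : forall x y n z, / d x y < INR n -> P n z ->
     Rabs (fst z - x) < d x y -> Rabs (snd z - y) < d x y -> False).
  { intros x y. exact (proj2_sig (constructive_indefinite_description _ (Hd x y))). }
  destruct (compactness_value_2d (- M) M (- M) M d) as [e He].
  destruct (nfloor_ex (/ e)) as [n [_ Hn]].
  { apply Rlt_le, Rinv_0_lt_compat, cond_pos. }
  rewrite <- S_INR in Hn.
  destruct (HP (S n)) as [z [Pz Mz]].
  assert (M1 := abs_fst_le_Cmod z). assert (M2 := abs_snd_le_Cmod z).
  apply (He (fst z) (snd z)).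
  - apply Rabs_le_between. lra.
  - apply Rabs_le_between. lra.
  - intros [x [y [_ [_ [Hx [Hy Hle]]]]]].
    apply (Hd' x y (S n) z); try assumption.
    eapply Rle_lt_trans; [|exact Hn]. apply Rinv_le_contravar; [apply cond_pos|assumption].
Qed.

Lemma continuous_attains_max (r : R) (h : C -> R) :
  0 <= r ->
  (forall z, Cmod z <= r -> forall eps, 0 < eps -> exists delta, 0 < delta /\
     forall w, cdist w z < delta -> Rabs (h w - h z) < eps) ->
  exists a, Cmod a <= r /\ forall z, Cmod z <= r -> h z <= h a.
Proof.
  intros Hr Hc.
  (* Used twice: with values [>= n] to show that [h] is bounded, and with values close to the
     supremum to show that it is attained. *)
  assert (Hlim : forall P : nat -> R -> Prop,
     (forall n, exists z, P n (h z) /\ Cmod z <= r) ->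
     exists a, Cmod a <= r /\ forall eps, 0 < eps -> forall N, exists n t,
       (N <= n)%nat /\ P n t /\ Rabs (t - h a) < eps).
  { intros P HP.
    destruct (accumulation_point (fun n z => P n (h z) /\ Cmod z <= r) r) as [a Ha].
    { intros n. destruct (HP n) as [z Hz]. exists z. tauto. }
    assert (Har : Cmod a <= r).
    { apply Rnot_lt_le. intros K. destruct (Ha (Cmod a - r) ltac:(lra) O) as [n [z [_ [[_ Hz] Hd]]]].
      rewrite cdist_sym in Hd. generalize (Cmod_triangle_inv a z). lra. }
    exists a. split; [assumption|]. intros eps Heps N.
    destruct (Hc a Har eps Heps) as [dl [Hdl K]].
    destruct (Ha dl Hdl N) as [n [z [Hn [[Hz _] Hd]]]].
    exists n, (h z). auto. }
  destruct (completeness (fun t => exists z, Cmod z <= r /\ t = h z)) as [m [Hm1 Hm2]].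
  - apply NNPP. intros Hnb.
    destruct (Hlim (fun n t => INR n <= t)) as [a [_ Ha]].
    { intros n. apply NNPP. intros H. apply Hnb. exists (INR n).
      intros t [z [Hz ->]]. apply Rnot_lt_le. intros K. apply H. exists z. lra. }
    destruct (INR_unbounded (h a + 1)) as [N HN].
    destruct (Ha 1 Rlt_0_1 N) as [n [t [Hn [Ht Hd]]]].
    apply le_INR in Hn. apply Rabs_lt_between in Hd. lra.
  - exists (h 0), 0. rewrite Cmod_0. auto.
  - destruct (Hlim (fun n t => m - / INR (S n) < t)) as [a [Har Ha]].
    { intros n. apply NNPP. intros H.
      assert (0 < / INR (S n)) by (apply Rinv_0_lt_compat, lt_0_INR; lia).
      specialize (Hm2 (m - / INR (S n))). apply (Rle_not_lt _ _ (Hm2 ltac:(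
        intros t [z [Hz ->]]; apply Rnot_lt_le; intros K; apply H; exists z; lra))). lra. }
    exists a. split; [assumption|]. intros z Hz.
    apply Rle_trans with m; [apply Hm1; now exists z|].
    apply Rnot_lt_le. intros K.
    destruct (archimed_cor1 ((m - h a) / 2) ltac:(lra)) as [N [HN HN0]].
    destruct (Ha ((m - h a) / 2) ltac:(lra) N) as [n [t [Hn [Ht Hd]]]].
    assert (/ INR (S n) <= / INR N).
    { apply Rinv_le_contravar; [now apply lt_0_INR|apply le_INR; lia]. }
    apply Rabs_lt_between in Hd. lra.
Qed.

(** * Complex derivatives and the mean value property *)

(** The form without quotients, valid also at [w = z], lets the rules of differentiation be proved
    by adding errors. *)
Definition has_cderiv (f : C -> C) (z l : C) : Prop :=
  forall eta, 0 < eta -> exists delta, 0 < delta /\ forall w, cdist w z < delta ->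
    Cmod (f w - f z - l * (w - z)) <= eta * cdist w z.

Definition ccontinuous (f : C -> C) (z : C) : Prop :=
  forall eps, 0 < eps -> exists delta, 0 < delta /\ forall w, cdist w z < delta ->
    cdist (f w) (f z) < eps.

Lemma has_cderiv_of_differentiable (f : C -> C) (z : C) :
  c_differentiable_at f z -> exists l, has_cderiv f z l.
Proof.
  intros [l Hl]. exists l. intros eta Heta.
  destruct (Hl eta Heta) as [d [Hd H]]. exists d. split; [assumption|].
  intros w Hw. destruct (Ceq_dec w z) as [->|Hwz].
  { replace (f z - f z - l * (z - z))%C with (RtoC 0) by ring.
    rewrite Cmod_0, cdist_refl. lra. }
  assert (Hne : (w - z)%C <> 0).
  { intros E. apply Hwz. replace w with ((w - z) + z)%C by ring. rewrite E. ring. }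
  specialize (H (w - z)%C (conj (proj1 (Cmod_gt_0 _) Hne) Hw)).
  replace (z + (w - z))%C with w in H by ring. unfold cdist in *.
  replace (f w - f z - l * (w - z))%C with (((f w - f z) / (w - z) - l) * (w - z))%C
    by (field; assumption).
  rewrite Cmod_mult. apply Rmult_le_compat_r; [apply Cmod_ge_0|lra].
Qed.

Lemma has_cderiv_lipschitz (f : C -> C) (z l : C) :
  has_cderiv f z l -> exists delta, 0 < delta /\ forall w, cdist w z < delta ->
    cdist (f w) (f z) <= (Cmod l + 1) * cdist w z.
Proof.
  intros H. destruct (H 1 Rlt_0_1) as [d [Hd K]]. exists d. split; [assumption|].
  intros w Hw. specialize (K w Hw). unfold cdist at 1.
  replace (f w - f z)%C with ((f w - f z - l * (w - z)) + l * (w - z))%C by ring.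
  eapply Rle_trans; [apply Cmod_triangle|]. rewrite Cmod_mult. unfold cdist in *. lra.
Qed.

Lemma has_cderiv_continuous (f : C -> C) (z l : C) :
  has_cderiv f z l -> ccontinuous f z.
Proof.
  intros H eps Heps. destruct (has_cderiv_lipschitz f z l H) as [d [Hd K]].
  assert (Hl := Cmod_ge_0 l).
  exists (Rmin d (eps / (Cmod l + 1))). split.
  { apply Rmin_pos; [assumption|]. apply Rdiv_lt_0_compat; lra. }
  intros w Hw. eapply Rle_lt_trans; [apply K|].
  { eapply Rlt_le_trans; [exact Hw|apply Rmin_l]. }
  assert (Hw' : cdist w z < eps / (Cmod l + 1)).
  { eapply Rlt_le_trans; [exact Hw|apply Rmin_r]. }
  apply Rlt_le_trans with ((Cmod l + 1) * (eps / (Cmod l + 1))).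
  - apply Rmult_lt_compat_l; lra.
  - right. field. lra.
Qed.

Lemma has_cderiv_affine (p q z : C) : has_cderiv (fun w => p * w + q)%C z p.
Proof.
  intros eta Heta. exists 1. split; [lra|]. intros w _.
  replace (p * w + q - (p * z + q) - p * (w - z))%C with (RtoC 0) by ring.
  rewrite Cmod_0. apply Rmult_le_pos; [lra|apply Cmod_ge_0].
Qed.

Lemma has_cderiv_comp (f g : C -> C) (z l m : C) :
  has_cderiv f z l -> has_cderiv g (f z) m ->
  has_cderiv (fun w => g (f w)) z (m * l)%C.
Proof.
  intros Hf Hg eta Heta.
  destruct (has_cderiv_lipschitz f z l Hf) as [d1 [Hd1 K1]].
  assert (Hl := Cmod_ge_0 l). assert (Hm := Cmod_ge_0 m).
  destruct (Hg (eta / (2 * (Cmod l + 1)))) as [d2 [Hd2 K2]].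
  { apply Rdiv_lt_0_compat; lra. }
  destruct (Hf (eta / (2 * (Cmod m + 1)))) as [d3 [Hd3 K3]].
  { apply Rdiv_lt_0_compat; lra. }
  destruct (has_cderiv_continuous f z l Hf d2 Hd2) as [d4 [Hd4 K4]].
  exists (Rmin (Rmin d1 d3) d4). split; [repeat apply Rmin_pos; assumption|].
  intros w Hw.
  assert (Hw1 : cdist w z < d1).
  { eapply Rlt_le_trans; [exact Hw|]. eapply Rle_trans; apply Rmin_l. }
  assert (Hw3 : cdist w z < d3).
  { eapply Rlt_le_trans; [exact Hw|]. eapply Rle_trans; [apply Rmin_l|apply Rmin_r]. }
  assert (Hw4 : cdist w z < d4).
  { eapply Rlt_le_trans; [exact Hw|apply Rmin_r]. }
  specialize (K1 w Hw1). specialize (K2 (f w) (K4 w Hw4)). specialize (K3 w Hw3).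
  replace (g (f w) - g (f z) - m * l * (w - z))%C with
    ((g (f w) - g (f z) - m * (f w - f z)) + m * (f w - f z - l * (w - z)))%C by ring.
  eapply Rle_trans; [apply Cmod_triangle|]. rewrite Cmod_mult.
  set (e := cdist w z) in *.
  assert (He : 0 <= e) by apply Cmod_ge_0.
  assert (T1 : eta / (2 * (Cmod l + 1)) * cdist (f w) (f z) <= eta / 2 * e).
  { apply Rle_trans with (eta / (2 * (Cmod l + 1)) * ((Cmod l + 1) * e)).
    - apply Rmult_le_compat_l; [apply Rlt_le, Rdiv_lt_0_compat; lra|assumption].
    - right. field. lra. }
  assert (T2 : Cmod m * Cmod (f w - f z - l * (w - z)) <= eta / 2 * e).
  { apply Rle_trans with ((Cmod m + 1) * (eta / (2 * (Cmod m + 1)) * e)).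
    - apply Rmult_le_compat; try apply Cmod_ge_0; lra.
    - right. field. lra. }
  lra.
Qed.

Lemma has_cderiv_mult (f g : C -> C) (z l m : C) :
  has_cderiv f z l -> has_cderiv g z m ->
  has_cderiv (fun w => f w * g w)%C z (l * g z + f z * m)%C.
Proof.
  intros Hf Hg eta Heta.
  assert (Hl := Cmod_ge_0 l). assert (Hfz := Cmod_ge_0 (f z)).
  assert (Hgz := Cmod_ge_0 (g z)).
  (* The sum of the factors of the three error terms in the decomposition of the product below;
     [Cmod (g z) + 1] bounds [g] near [z]. *)
  pose (B := Cmod (g z) + 1 + Cmod (f z) + Cmod l).
  assert (HB : 0 < B) by (unfold B; lra).
  assert (He' : 0 < eta / B) by (apply Rdiv_lt_0_compat; lra).
  destruct (Hf _ He') as [d1 [Hd1 K1]].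
  destruct (Hg _ He') as [d2 [Hd2 K2]].
  destruct (has_cderiv_continuous g z m Hg (Rmin 1 (eta / B))) as [d3 [Hd3 K3]].
  { apply Rmin_pos; lra. }
  exists (Rmin (Rmin d1 d2) d3). split; [repeat apply Rmin_pos; assumption|].
  intros w Hw.
  assert (Hw1 : cdist w z < d1).
  { eapply Rlt_le_trans; [exact Hw|]. eapply Rle_trans; apply Rmin_l. }
  assert (Hw2 : cdist w z < d2).
  { eapply Rlt_le_trans; [exact Hw|]. eapply Rle_trans; [apply Rmin_l|apply Rmin_r]. }
  assert (Hw3 : cdist w z < d3).
  { eapply Rlt_le_trans; [exact Hw|apply Rmin_r]. }
  specialize (K1 w Hw1). specialize (K2 w Hw2). specialize (K3 w Hw3).
  assert (K3a : cdist (g w) (g z) < 1) by (eapply Rlt_le_trans; [exact K3|apply Rmin_l]).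
  assert (K3b : cdist (g w) (g z) < eta / B) by (eapply Rlt_le_trans; [exact K3|apply Rmin_r]).
  replace (f w * g w - f z * g z - (l * g z + f z * m) * (w - z))%C with
    ((f w - f z - l * (w - z)) * g w + f z * (g w - g z - m * (w - z))
      + l * ((w - z) * (g w - g z)))%C by ring.
  eapply Rle_trans; [apply Cmod_triangle|].
  assert (T := Cmod_triangle ((f w - f z - l * (w - z)) * g w)
                 (f z * (g w - g z - m * (w - z)))).
  rewrite !Cmod_mult in *. fold (cdist w z) (cdist (g w) (g z)).
  set (e := cdist w z) in *.
  assert (He : 0 <= e) by apply Cmod_ge_0.
  assert (G := Cmod_triangle_inv (g w) (g z)).
  assert (T1 : Cmod (f w - f z - l * (w - z)) * Cmod (g w) <= (eta / B * e) * (Cmod (g z) + 1)).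
  { apply Rmult_le_compat; try apply Cmod_ge_0; lra. }
  assert (T2 : Cmod (f z) * Cmod (g w - g z - m * (w - z)) <= Cmod (f z) * (eta / B * e)).
  { apply Rmult_le_compat_l; lra. }
  assert (T3 : Cmod l * (e * cdist (g w) (g z)) <= Cmod l * (e * (eta / B))).
  { apply Rmult_le_compat_l; [lra|]. apply Rmult_le_compat_l; lra. }
  apply Rle_trans with ((eta / B * e) * B); [unfold B at 2; lra|].
  right. field. lra.
Qed.

Lemma has_cderiv_inv (z : C) : z <> 0 -> has_cderiv Cinv z (- / (z * z))%C.
Proof.
  intros Hz eta Heta. assert (Hm := proj1 (Cmod_gt_0 z) Hz).
  set (r := Cmod z) in *.
  (* The error is exactly [(w - z)^2 / (z^2 w)]. The first bound keeps [Cmod w] above [r / 2]; the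
     second then makes one factor [|w - z|] at most [eta * |z^2 w|]. *)
  exists (Rmin (r / 2) (eta * r ^ 3 / 2)). split.
  { apply Rmin_pos; [lra|]. assert (0 < r ^ 3) by now apply pow_lt. nra. }
  intros w Hw.
  assert (Hw1 : cdist w z < r / 2) by (eapply Rlt_le_trans; [exact Hw|apply Rmin_l]).
  assert (Hw2 : cdist w z < eta * r ^ 3 / 2) by (eapply Rlt_le_trans; [exact Hw|apply Rmin_r]).
  assert (Hwr : r / 2 < Cmod w).
  { generalize (Cmod_triangle_inv z w). rewrite cdist_sym. fold r. lra. }
  assert (Hw0 : w <> 0) by (apply Cmod_gt_0; lra).
  replace (/ w - / z - - / (z * z) * (w - z))%C with
    ((w - z) * (w - z) / (z * z * w))%C by (field; auto).
  rewrite Cmod_div by (repeat apply Cmult_neq_0; assumption).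
  rewrite !Cmod_mult. fold (cdist w z) r. set (e := cdist w z) in *.
  assert (He : 0 <= e) by apply Cmod_ge_0.
  assert (Hrw : 0 < r * r * Cmod w) by (apply Rmult_lt_0_compat; nra).
  apply Rmult_le_reg_r with (r * r * Cmod w); [assumption|].
  replace (e * e / (r * r * Cmod w) * (r * r * Cmod w)) with (e * e) by (field; lra).
  assert (r * r * (r / 2) <= r * r * Cmod w) by (apply Rmult_le_compat_l; nra).
  assert (e <= eta * (r * r * Cmod w)).
  { apply Rle_trans with (eta * (r * r * (r / 2))); [nra|].
    apply Rmult_le_compat_l; lra. }
  replace (eta * e * (r * r * Cmod w)) with (e * (eta * (r * r * Cmod w))) by ring.
  apply Rmult_le_compat_l; assumption.
Qed.

Lemma has_cderiv_cr_approx (f : C -> C) (x y : R) (l : C) :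
  has_cderiv f (x, y) l ->
  cr_approx (fun s t => fst (f (s, t))) (fun s t => snd (f (s, t))) x y.
Proof.
  intros H. exists (fst l), (snd l). intros eta Heta.
  destruct (H eta Heta) as [d [Hd K]]. exists (d / 2). split; [lra|].
  intros s t Hs Ht.
  assert (E : cdist (s, t) (x, y) <= Rabs (s - x) + Rabs (t - y)) by apply Cmod_le_abs.
  specialize (K (s, t) ltac:(lra)).
  assert (K' : Cmod (f (s, t) - f (x, y) - l * ((s, t) - (x, y)))
           <= eta * (Rabs (s - x) + Rabs (t - y))).
  { eapply Rle_trans; [exact K|]. apply Rmult_le_compat_l; lra. }
  assert (F1 := abs_fst_le_Cmod (f (s, t) - f (x, y) - l * ((s, t) - (x, y)))).
  assert (F2 := abs_snd_le_Cmod (f (s, t) - f (x, y) - l * ((s, t) - (x, y)))).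
  destruct (f (s, t)) as [f1 f2], (f (x, y)) as [g1 g2], l as [p q]. simpl in *.
  split.
  - eapply Rle_trans; [|exact K']. eapply Rle_trans; [|exact F1].
    right. f_equal. ring.
  - eapply Rle_trans; [|exact K']. eapply Rle_trans; [|exact F2].
    right. f_equal. ring.
Qed.

(** * The complex exponential *)

Definition cexp (z : C) : C := (exp (fst z) * cos (snd z), exp (fst z) * sin (snd z)).

Lemma cexp_plus (z w : C) : cexp (z + w) = (cexp z * cexp w)%C.
Proof.
  destruct z as [x y], w as [s t]. unfold cexp, Cplus, Cmult; simpl.
  rewrite exp_plus, cos_plus, sin_plus. f_equal; ring.
Qed.

Lemma Cmod_cexp (z : C) : Cmod (cexp z) = exp (fst z).
Proof.
  unfold Cmod, cexp; simpl fst; simpl snd.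
  replace ((exp (fst z) * cos (snd z)) ^ 2 + (exp (fst z) * sin (snd z)) ^ 2)
    with ((exp (fst z)) ^ 2).
  - apply sqrt_pow2. left. apply exp_pos.
  - generalize (sin2_cos2 (snd z)). unfold Rsqr. intros E.
    transitivity ((exp (fst z)) ^ 2 * (sin (snd z) * sin (snd z) + cos (snd z) * cos (snd z)));
      [rewrite E|]; ring.
Qed.

Lemma derivable_error_at_0 (f : R -> R) (l : R) :
  derivable_pt_lim f 0 l -> forall eta, 0 < eta -> exists delta, 0 < delta /\
    forall x, Rabs x < delta -> Rabs (f x - f 0 - l * x) <= eta * Rabs x.
Proof.
  intros H eta Heta. destruct (H eta Heta) as [d Hd].
  exists d. split; [apply cond_pos|]. intros x Hx.
  destruct (Req_dec x 0) as [->|Hx0].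
  { replace (f 0 - f 0 - l * 0) with 0 by ring. rewrite Rabs_R0. lra. }
  specialize (Hd x Hx0 Hx). rewrite Rplus_0_l in Hd.
  replace (f x - f 0 - l * x) with (((f x - f 0) / x - l) * x) by (field; assumption).
  rewrite Rabs_mult. apply Rmult_le_compat_r; [apply Rabs_pos|lra].
Qed.

Lemma has_cderiv_cexp_0 : has_cderiv cexp 0 1.
Proof.
  intros eta Heta.
  (* With relative error [e] in [exp], [sin] and [cos], the two coordinates below are off by at most
     [3 * e * r] and [4 * e * r], hence [eta / 8]. The bound [1 / 2] gives [|1 + x| <= 2] and
     [|sin y| <= 2 * r]. *)
  pose (e := Rmin (eta / 8) (1 / 2)).
  assert (He : 0 < e) by (apply Rmin_pos; lra).
  assert (He1 : e <= eta / 8) by apply Rmin_l.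
  assert (He2 : e <= 1 / 2) by apply Rmin_r.
  clearbody e.
  destruct (derivable_error_at_0 exp 1) with (eta := e) as [d1 [Hd1 K1]];
    [generalize (derivable_pt_lim_exp 0); now rewrite exp_0|assumption|].
  destruct (derivable_error_at_0 sin 1) with (eta := e) as [d2 [Hd2 K2]];
    [generalize (derivable_pt_lim_sin 0); now rewrite cos_0|assumption|].
  destruct (derivable_error_at_0 cos 0) with (eta := e) as [d3 [Hd3 K3]];
    [generalize (derivable_pt_lim_cos 0); now rewrite sin_0, Ropp_0|assumption|].
  exists (Rmin (Rmin d1 d2) (Rmin d3 e)).
  split; [repeat apply Rmin_pos; assumption|].
  intros [x y] Hw. unfold cdist in *.
  replace ((x, y) - 0)%C with ((x, y) : C) in * by (unfold Cminus, Cplus, Copp; simpl; f_equal; ring).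
  assert (Hx := abs_fst_le_Cmod (x, y)). assert (Hy := abs_snd_le_Cmod (x, y)). simpl in Hx, Hy.
  assert (M1 := Rmin_l (Rmin d1 d2) (Rmin d3 e)). assert (M2 := Rmin_r (Rmin d1 d2) (Rmin d3 e)).
  assert (M3 := Rmin_l d1 d2). assert (M4 := Rmin_r d1 d2).
  assert (M5 := Rmin_l d3 e). assert (M6 := Rmin_r d3 e).
  specialize (K1 x ltac:(lra)). specialize (K2 y ltac:(lra)). specialize (K3 y ltac:(lra)).
  rewrite exp_0 in K1. rewrite sin_0 in K2. rewrite cos_0 in K3.
  set (r := Cmod (x, y)) in *. assert (Hr : 0 <= r) by apply Cmod_ge_0.
  assert (Hre : r < e) by lra.
  replace (cexp (x, y) - cexp 0 - 1 * (x, y))%C with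
    ((exp x - 1 - 1 * x) * cos y + (1 + x) * (cos y - 1 - 0 * y),
     (exp x - 1 - 1 * x) * sin y + x * sin y + (sin y - 0 - 1 * y)).
  2:{ unfold cexp, Cminus, Cplus, Copp, Cmult; simpl. rewrite exp_0, cos_0, sin_0.
      f_equal; ring. }
  eapply Rle_trans; [apply Cmod_le_abs|].
  set (E := exp x - 1 - 1 * x) in *. set (K := cos y - 1 - 0 * y) in *.
  set (S := sin y - 0 - 1 * y) in *.
  assert (B1 : Rabs E <= e * r) by nra.
  assert (B2 : Rabs K <= e * r) by nra.
  assert (B3 : Rabs S <= e * r) by nra.
  assert (Hcos : Rabs (cos y) <= 1) by (apply Rabs_le_between; generalize (COS_bound y); lra).
  assert (Hsin : Rabs (sin y) <= 1) by (apply Rabs_le_between; generalize (SIN_bound y); lra).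
  assert (Hsin2 : Rabs (sin y) <= 2 * r).
  { replace (sin y) with (S + y) by (unfold S; ring).
    eapply Rle_trans; [apply Rabs_triang|]. nra. }
  assert (H1x : Rabs (1 + x) <= 2).
  { eapply Rle_trans; [apply Rabs_triang|]. rewrite Rabs_R1. lra. }
  assert (P := Rabs_pos). pose proof (P E); pose proof (P K); pose proof (P S);
    pose proof (P (sin y)); pose proof (P (cos y)); pose proof (P x); pose proof (P (1 + x)).
  assert (A1 : Rabs (E * cos y + (1 + x) * K) <= e * r + 2 * (e * r)).
  { eapply Rle_trans; [apply Rabs_triang|]. rewrite !Rabs_mult.
    apply Rplus_le_compat; [|apply Rmult_le_compat; assumption].
    rewrite <- (Rmult_1_r (e * r)). apply Rmult_le_compat; assumption. }
  assert (A2 : Rabs (E * sin y + x * sin y + S) <= e * r + e * (2 * r) + e * r).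
  { eapply Rle_trans; [apply Rabs_triang|]. apply Rplus_le_compat; [|assumption].
    eapply Rle_trans; [apply Rabs_triang|]. rewrite !Rabs_mult. apply Rplus_le_compat.
    - rewrite <- (Rmult_1_r (e * r)). apply Rmult_le_compat; assumption.
    - apply Rmult_le_compat; lra. }
  assert (e * r <= eta / 8 * r) by (apply Rmult_le_compat_r; assumption).
  nra.
Qed.

Lemma has_cderiv_cexp (z : C) : has_cderiv cexp z (cexp z).
Proof.
  intros eta Heta. assert (Hz : 0 < Cmod (cexp z)) by (rewrite Cmod_cexp; apply exp_pos).
  destruct (has_cderiv_cexp_0 (eta / Cmod (cexp z))) as [d [Hd K]].
  { now apply Rdiv_lt_0_compat. }
  exists d. split; [assumption|]. intros w Hw.
  assert (E : cdist (w - z) 0 = cdist w z) by (unfold cdist; f_equal; ring).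
  specialize (K (w - z)%C ltac:(lra)). rewrite E in K.
  replace (cexp w) with (cexp z * cexp (w - z))%C
    by (rewrite <- cexp_plus; f_equal; ring).
  assert (E0 : cexp 0 = 1).
  { unfold cexp; simpl. rewrite exp_0, cos_0, sin_0. unfold RtoC. f_equal; ring. }
  rewrite E0 in K.
  replace (cexp z * cexp (w - z) - cexp z - cexp z * (w - z))%C with
    (cexp z * (cexp (w - z) - 1 - 1 * (w - z - 0)))%C by ring.
  rewrite Cmod_mult.
  apply Rle_trans with (Cmod (cexp z) * (eta / Cmod (cexp z) * cdist w z)).
  - apply Rmult_le_compat_l; lra.
  - right. field. lra.
Qed.

(** * Means over circles *)

Definition circle_point (a : C) (r t : R) : C := (a + (r * cos t, r * sin t)%R)%C.

Lemma cdist_circle_point (a : C) (r t : R) : 0 < r -> cdist (circle_point a r t) a = r.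
Proof.
  intros Hr. unfold cdist, circle_point.
  replace (a + (r * cos t, r * sin t)%R - a)%C with (cexp (ln r, t)).
  - rewrite Cmod_cexp. now apply exp_ln.
  - unfold cexp; simpl fst; simpl snd. rewrite exp_ln by assumption.
    destruct a as [a1 a2]. unfold Cminus, Cplus, Copp; simpl. f_equal; ring.
Qed.

(* In the coordinate [log (z - a)] a punctured disc is a half-strip; Goursat on
   a rectangle of that strip shows that circle means do not depend on the radius. *)
Lemma mean_value (f : C -> C) (a : C) (r : R) :
  0 < r ->
  (forall z, 0 < cdist z a <= r -> exists l, has_cderiv f z l) ->
  ccontinuous f a ->
  is_RInt (fun t => fst (f (circle_point a r t))) 0 (2 * PI) (2 * PI * fst (f a)).
Proof.
  intros Hr Hf Hc. assert (HPI := PI_RGT_0).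
  pose (F := fun z => f (1 * cexp z + a)%C).
  pose (u := fun s t => fst (F (s, t))). pose (v := fun s t => snd (F (s, t))).
  assert (Hcr : forall s t, s <= ln r -> cr_approx u v s t).
  { intros s t Hs. destruct (Hf (1 * cexp (s, t) + a)%C) as [l Hl].
    - unfold cdist. replace (1 * cexp (s, t) + a - a)%C with (cexp (s, t)) by ring.
      rewrite Cmod_cexp. simpl. split; [apply exp_pos|].
      rewrite <- (exp_ln r Hr). destruct Hs as [Hs| ->]; [|lra].
      left. now apply exp_increasing.
    - eapply has_cderiv_cr_approx. unfold F.
      apply (has_cderiv_comp (fun z => 1 * cexp z + a)%C f); [|exact Hl].
      apply (has_cderiv_comp cexp (fun z => 1 * z + a)%C).
      + apply has_cderiv_cexp.
      + apply has_cderiv_affine. }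
  assert (Hu : forall s, s <= ln r -> ex_RInt (fun t => u s t) 0 (2 * PI)).
  { intros s Hs. apply (ex_RInt_continuous (V := R_CompleteNormedModule)).
    intros t _. apply continuous_eps. intros eps Heps.
    destruct (cr_approx_continuous u v s t (Hcr s t Hs) eps Heps) as [d [Hd K]].
    exists d. split; [assumption|]. intros t' Ht'. apply K; [|assumption].
    replace (s - s) with 0 by ring. now rewrite Rabs_R0. }
  assert (Hconst : forall s, s <= ln r ->
     RInt (fun t => u s t) 0 (2 * PI) = RInt (fun t => u (ln r) t) 0 (2 * PI)).
  { intros s Hs.
    assert (G : im_boundary u v s (ln r) 0 (2 * PI) = 0).
    { apply goursat_rectangle; [assumption|lra|]. intros x y Hx _. apply Hcr. lra. }
    (* The horizontal sides cancel because [cexp] has period [2 * PI * i]; the two vertical sides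
       are the circle integrals of the real part at radii [exp s] and [r]. *)
    unfold im_boundary in G.
    rewrite (RInt_ext (fun x => v x (2 * PI)) (fun x => v x 0)) in G; [lra|].
    intros x _. unfold v, F, cexp; simpl fst; simpl snd.
    now rewrite cos_2PI, sin_2PI, cos_0, sin_0. }
  (* The strip never reaches the centre; continuity at [a] identifies the common value on a small
     circle. If the values differed by [D], closeness to [f a] within [D / (4 * PI)] would give an
     error of at most [D / 2]. *)
  assert (Hval : RInt (fun t => u (ln r) t) 0 (2 * PI) = 2 * PI * fst (f a)).
  { apply Rminus_diag_uniq. apply NNPP. intros Hne. apply Rabs_pos_lt in Hne.
    set (D := Rabs _) in Hne.
    destruct (Hc (D / (4 * PI))) as [d [Hd K]]; [apply Rdiv_lt_0_compat; lra|].
    pose (s := Rmin (ln r) (ln (d / 2))).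
    assert (Hs : s <= ln r) by apply Rmin_l.
    assert (B : Rabs (RInt (fun t => u s t) 0 (2 * PI) -
       (fst (f a) * (2 * PI - 0) + 0 * ((2 * PI) ^ 2 - 0 ^ 2) / 2))
       <= (2 * PI - 0) * (D / (4 * PI))).
    { apply RInt_near_affine; [lra|now apply Hu|]. intros t _.
      rewrite Rmult_0_l, Rplus_0_r.
      assert (L : cdist (1 * cexp (s, t) + a) a < d).
      { unfold cdist. replace (1 * cexp (s, t) + a - a)%C with (cexp (s, t)) by ring.
        rewrite Cmod_cexp. simpl. apply Rle_lt_trans with (d / 2); [|lra].
        rewrite <- (exp_ln (d / 2)) by lra.
        destruct (Rmin_r (ln r) (ln (d / 2))) as [Q|Q]; fold s in Q.
        - left. now apply exp_increasing.
        - rewrite Q. lra. }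
      specialize (K _ L). eapply Rle_trans; [|left; exact K].
      unfold u, F. exact (abs_fst_le_Cmod (f (1 * cexp (s, t) + a) - f a)%C). }
    rewrite (Hconst s Hs) in B.
    replace (fst (f a) * (2 * PI - 0) + 0 * ((2 * PI) ^ 2 - 0 ^ 2) / 2)
      with (2 * PI * fst (f a)) in B by field.
    fold D in B.
    replace ((2 * PI - 0) * (D / (4 * PI))) with (D / 2) in B by (field; lra). lra. }
  rewrite <- Hval.
  apply (is_RInt_ext (fun t => u (ln r) t)).
  - intros t _. unfold u, F, cexp, circle_point; simpl fst; simpl snd.
    rewrite exp_ln by assumption. do 2 f_equal.
    destruct a as [a1 a2]. unfold Cplus, Cmult; simpl. f_equal; ring.
  - apply (RInt_correct (V := R_CompleteNormedModule)). apply Hu. lra.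
Qed.

(** * Schwarz-Pick and the Kobayashi distance *)

Lemma Cmod_sqr (z : C) : Cmod z ^ 2 = fst z ^ 2 + snd z ^ 2.
Proof. apply Cmod2_alt. Qed.

Lemma sqr_continuous_eps (r z : R) (eps : R) :
  0 <= z <= r -> 0 < eps -> exists delta, 0 < delta /\ forall w, 0 <= w ->
    Rabs (w - z) < delta -> Rabs (w ^ 2 - z ^ 2) < eps.
Proof.
  intros Hz Heps. exists (Rmin 1 (eps / (2 * r + 1))).
  assert (Hp : 0 < eps / (2 * r + 1)) by (apply Rdiv_lt_0_compat; lra).
  split; [apply Rmin_pos; lra|]. intros w Hw Hd.
  assert (D1 := Rlt_le_trans _ _ _ Hd (Rmin_l _ _)).
  assert (D2 := Rlt_le_trans _ _ _ Hd (Rmin_r _ _)).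
  replace (w ^ 2 - z ^ 2) with ((w - z) * (w + z)) by ring.
  rewrite Rabs_mult, (Rabs_pos_eq (w + z)) by lra.
  apply Rabs_lt_between in D1.
  apply Rle_lt_trans with (Rabs (w - z) * (2 * r + 1)).
  - apply Rmult_le_compat_l; [apply Rabs_pos|lra].
  - replace eps with (eps / (2 * r + 1) * (2 * r + 1)) by (field; lra).
    apply Rmult_lt_compat_r; lra.
Qed.

Lemma abs_Cmod_sub_le (z w : C) : Rabs (Cmod z - Cmod w) <= cdist z w.
Proof.
  apply Rabs_le_between. generalize (Cmod_triangle_inv z w) (Cmod_triangle_inv w z).
  rewrite (cdist_sym w z). lra.
Qed.

(* At an interior maximum [a] of [|g z| + e |z|^2] the mean value property of
   [g] is contradicted, because the mean of [|z|^2] over a circle of radius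
   [rho] about [a] is [|a|^2 + rho^2]. *)
Lemma maximum_principle (g : C -> C) (r B : R) :
  0 < r ->
  (forall z, 0 < Cmod z <= r -> exists l, has_cderiv g z l) ->
  ccontinuous g 0 ->
  (forall z, Cmod z = r -> Cmod (g z) <= B) ->
  forall z, Cmod z <= r -> Cmod (g z) <= B.
Proof.
  intros Hr Hg Hg0 HB z0 Hz0. apply Rnot_lt_le. intros Hlt.
  assert (Hc : forall z, Cmod z <= r -> ccontinuous g z).
  { intros z Hz. destruct (Ceq_dec z 0) as [->|Hne]; [assumption|].
    destruct (Hg z) as [l Hl]; [split; [now apply Cmod_gt_0|assumption]|].
    now apply has_cderiv_continuous with l. }
  (* Half of the excess over [B], spread over [r ^ 2]: the perturbation [e * |z|^2] is then too
     small to move the maximum to the circle, and too small to let [g] vanish at it. *)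
  pose (e := (Cmod (g z0) - B) / (2 * r ^ 2)).
  assert (Hr2 : 0 < r ^ 2) by now apply pow_lt.
  assert (He : 0 < e) by (apply Rdiv_lt_0_compat; lra).
  assert (Her : e * r ^ 2 = (Cmod (g z0) - B) / 2) by (unfold e; field; lra).
  assert (HB0 : 0 <= B).
  { eapply Rle_trans; [apply Cmod_ge_0|apply (HB r)]. rewrite Cmod_R. apply Rabs_pos_eq; lra. }
  clearbody e.
  destruct (continuous_attains_max r (fun z => Cmod (g z) + e * Cmod z ^ 2)) as [a [Ha Hmax]].
  { lra. }
  { intros z Hz eps Heps.
    destruct (Hc z Hz (eps / 2)) as [d1 [Hd1 K1]]; [lra|].
    destruct (sqr_continuous_eps r (Cmod z) (eps / 2 / e)) as [d2 [Hd2 K2]].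
    { split; [apply Cmod_ge_0|assumption]. }
    { apply Rdiv_lt_0_compat; lra. }
    exists (Rmin d1 d2). split; [now apply Rmin_pos|]. intros w Hw.
    specialize (K1 w (Rlt_le_trans _ _ _ Hw (Rmin_l _ _))).
    specialize (K2 (Cmod w) (Cmod_ge_0 w) (Rle_lt_trans _ _ _ (abs_Cmod_sub_le w z)
      (Rlt_le_trans _ _ _ Hw (Rmin_r _ _)))).
    replace (Cmod (g w) + e * Cmod w ^ 2 - (Cmod (g z) + e * Cmod z ^ 2)) with
      ((Cmod (g w) - Cmod (g z)) + e * (Cmod w ^ 2 - Cmod z ^ 2)) by ring.
    eapply Rle_lt_trans; [apply Rabs_triang|].
    rewrite (Rabs_mult e), (Rabs_pos_eq e) by lra.
    assert (T := abs_Cmod_sub_le (g w) (g z)).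
    apply (Rmult_lt_compat_l e) in K2; [|lra].
    replace (e * (eps / 2 / e)) with (eps / 2) in K2 by (field; lra). lra. }
  assert (Hm0 := Hmax z0 Hz0).
  assert (Q0 : 0 <= e * Cmod z0 ^ 2) by (apply Rmult_le_pos; [lra|apply pow2_ge_0]).
  assert (Ha0 := Cmod_ge_0 a).
  assert (Qa : e * Cmod a ^ 2 <= e * r ^ 2).
  { apply Rmult_le_compat_l; [lra|]. apply pow_incr. lra. }
  assert (Har : Cmod a < r).
  { destruct Ha as [Ha|Ha]; [assumption|]. specialize (HB a Ha). rewrite Ha in *. lra. }
  assert (Hga : 0 < Cmod (g a)) by lra.
  (* [mean_value] allows an exceptional point only at the centre, and 0 is exceptional for [g]. So
     either [a] is 0 or the disc about [a] must avoid 0. *)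
  assert (Hrho : exists rho, 0 < rho /\ Cmod a + rho <= r /\
     forall z, 0 < cdist z a <= rho -> 0 < Cmod z).
  { destruct (Ceq_dec a 0) as [->|Hne].
    - exists (r / 2). rewrite Cmod_0. repeat split; try lra.
      intros z Hz. unfold cdist in Hz. now replace (z - 0)%C with z in Hz by ring.
    - apply Cmod_gt_0 in Hne. exists (Rmin (Cmod a / 2) (r - Cmod a)).
      assert (R1 := Rmin_l (Cmod a / 2) (r - Cmod a)).
      assert (R2 := Rmin_r (Cmod a / 2) (r - Cmod a)).
      repeat split; [apply Rmin_pos; lra|lra|].
      intros z Hz. generalize (Cmod_triangle_inv a z). rewrite cdist_sym. lra. }
  destruct Hrho as [rho [Hrho [Hrho1 Hrho2]]].
  assert (Hdisc : forall z, cdist z a <= rho -> Cmod z <= r).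
  { intros z Hz. generalize (Cmod_triangle_inv z a). lra. }
  (* A unimodular factor turning [g a] into [|g a|]. The real part of [c * g] then has mean [|g a|],
     while maximality of [a] bounds it pointwise by a function of mean [|g a| - e * rho ^ 2]. *)
  pose (c := (Cconj (g a) / Cmod (g a))%C).
  assert (Hgane : RtoC (Cmod (g a)) <> 0).
  { intros E. apply RtoC_inj in E. lra. }
  assert (Hcmod : Cmod c = 1).
  { unfold c. rewrite Cmod_div, Cmod_conj, Cmod_R, Rabs_pos_eq by (assumption || lra).
    field. lra. }
  assert (Hcga : (c * g a + 0)%C = Cmod (g a)).
  { transitivity ((g a * Cconj (g a)) / Cmod (g a))%C; [unfold c; field; assumption|].
    rewrite <- Cmod2_conj.
    replace (Cmod (g a) ^ 2) with (Cmod (g a) * Cmod (g a)) by ring.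
    rewrite RtoC_mult. field. assumption. }
  assert (I1 := mean_value (fun z => c * g z + 0)%C a rho Hrho).
  cbv beta in I1. rewrite Hcga in I1. simpl (fst (RtoC _)) in I1.
  assert (I2 : is_RInt (fun t => Cmod (g a) + e * Cmod a ^ 2 -
      e * Cmod (circle_point a rho t) ^ 2) 0 (2 * PI) (2 * PI * (Cmod (g a) - e * rho ^ 2))).
  { apply (is_RInt_ext (fun t => Cmod (g a) - e * rho ^ 2
      - 2 * e * rho * (fst a * cos t + snd a * sin t))).
    { intros t _. rewrite !Cmod_sqr. unfold circle_point. simpl fst; simpl snd.
      generalize (sin2_cos2 t). unfold Rsqr. intros E.
      replace (e * rho ^ 2) with (e * rho ^ 2 * (sin t * sin t + cos t * cos t))
        by (rewrite E; ring).
      match goal with |- ?x = ?y => change (@eq R x y) end. ring. }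
    replace (2 * PI * (Cmod (g a) - e * rho ^ 2)) with
      (minus ((Cmod (g a) - e * rho ^ 2) * (2 * PI)
          - 2 * e * rho * (fst a * sin (2 * PI) - snd a * cos (2 * PI)))
        ((Cmod (g a) - e * rho ^ 2) * 0 - 2 * e * rho * (fst a * sin 0 - snd a * cos 0))).
    2:{ rewrite sin_2PI, cos_2PI, sin_0, cos_0. unfold minus, plus, opp; simpl. ring. }
    apply (is_RInt_derive (fun t => (Cmod (g a) - e * rho ^ 2) * t
          - 2 * e * rho * (fst a * sin t - snd a * cos t))).
    - intros t _. auto_derive; [trivial|]. ring.
    - intros t _. apply (ex_derive_continuous (V := R_NormedModule) (fun t => Cmod (g a) - e * rho ^ 2
      - 2 * e * rho * (fst a * cos t + snd a * sin t))). auto_derive. trivial. }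
  assert (HPI := PI_RGT_0).
  assert (L : 2 * PI * Cmod (g a) <= 2 * PI * (Cmod (g a) - e * rho ^ 2)).
  { eapply is_RInt_le; [|apply I1|apply I2|].
    - lra.
    - intros z Hz. destruct (Hg z) as [l Hl].
      { split; [now apply Hrho2|]. apply Hdisc. lra. }
      exists (c * l)%C. apply (has_cderiv_comp g (fun w => c * w + 0)%C); [assumption|].
      apply has_cderiv_affine.
    - destruct (has_cderiv_lipschitz (fun w => c * w + 0)%C (g a) c (has_cderiv_affine _ _ _))
        as [d1 [Hd1 K1]].
      intros eps Heps.
      destruct (Hc a Ha (Rmin d1 (eps / (Cmod c + 1)))) as [d2 [Hd2 K2]].
      { apply Rmin_pos; [assumption|]. apply Rdiv_lt_0_compat; lra. }
      exists d2. split; [assumption|]. intros w Hw. specialize (K2 w Hw).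
      eapply Rle_lt_trans; [apply K1|].
      + eapply Rlt_le_trans; [exact K2|apply Rmin_l].
      + assert (M := Rmin_r d1 (eps / (Cmod c + 1))). rewrite Hcmod in K2, M |- *. lra.
    - intros t _. cbv beta. set (z := circle_point a rho t).
      assert (Hz : Cmod z <= r).
      { apply Hdisc. right. now apply cdist_circle_point. }
      assert (F := abs_fst_le_Cmod (c * g z + 0)%C).
      replace (Cmod (c * g z + 0)) with (Cmod (g z)) in F
        by (replace (c * g z + 0)%C with (c * g z)%C by ring; rewrite Cmod_mult, Hcmod; ring).
      specialize (Hmax z Hz). cbv beta in Hmax.
      apply Rabs_le_between in F. lra. }
  apply Rmult_le_reg_l in L; [|lra].
  assert (0 < e * rho ^ 2) by (apply Rmult_lt_0_compat; [assumption|now apply pow_lt]). lra.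
Qed.

(** * The Schwarz lemma and Moebius maps of the disc *)

Definition cholomorphic_disc (f : C -> C) : Prop :=
  forall z, unit_disc z -> exists l, has_cderiv f z l.

Lemma has_cderiv_ext_loc (f g : C -> C) (z l : C) :
  (exists delta, 0 < delta /\ forall w, cdist w z < delta -> f w = g w) ->
  has_cderiv f z l -> has_cderiv g z l.
Proof.
  intros [d [Hd E]] H eta Heta. destruct (H eta Heta) as [d' [Hd' K]].
  exists (Rmin d d'). split; [now apply Rmin_pos|]. intros w Hw.
  rewrite <- !E; [| |].
  - apply K. eapply Rlt_le_trans; [exact Hw|apply Rmin_r].
  - now rewrite cdist_refl.
  - eapply Rlt_le_trans; [exact Hw|apply Rmin_l].
Qed.

Lemma schwarz_lemma (f : C -> C) :
  cholomorphic_disc f -> (forall z, unit_disc z -> unit_disc (f z)) -> f 0 = 0 ->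
  forall z, unit_disc z -> Cmod (f z) <= Cmod z.
Proof.
  intros Hf Hmap Hf0 z0 Hz0. unfold unit_disc in *.
  destruct (Hf 0) as [l0 Hl0]; [unfold unit_disc; rewrite Cmod_0; lra|].
  (* The value [l0 = f'(0)] makes the quotient continuous at 0, which is all that
     [maximum_principle] asks there. *)
  pose (g := fun z => if Ceq_dec z 0 then l0 else (f z * / z)%C).
  assert (Hg0 : ccontinuous g 0).
  { intros eps Heps. destruct (Hl0 (eps / 2)) as [d [Hd K]]; [lra|].
    exists d. split; [assumption|]. intros w Hw. unfold g.
    destruct (Ceq_dec 0 0) as [_|N]; [|easy].
    destruct (Ceq_dec w 0) as [->|Hw0]; [now rewrite cdist_refl|].
    specialize (K w Hw). rewrite Hf0 in K. unfold cdist in *.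
    replace (w - 0)%C with w in * by ring. apply Cmod_gt_0 in Hw0 as Hwp.
    replace (f w * / w - l0)%C with ((f w - 0 - l0 * w) / w)%C by (field; assumption).
    rewrite Cmod_div by assumption. apply Rle_lt_trans with (eps / 2); [|lra].
    apply Rmult_le_reg_r with (Cmod w); [assumption|].
    unfold Rdiv. rewrite Rmult_assoc, Rinv_l by lra. lra. }
  assert (Hgd : forall z, 0 < Cmod z < 1 -> exists l, has_cderiv g z l).
  { intros z [Hz Hz1]. destruct (Hf z Hz1) as [l Hl]. assert (Hz' := proj2 (Cmod_gt_0 z) Hz).
    eexists. eapply has_cderiv_ext_loc;
      [|apply (has_cderiv_mult f Cinv); [exact Hl|now apply has_cderiv_inv]].
    exists (Cmod z). split; [assumption|]. intros w Hw. unfold g.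
    destruct (Ceq_dec w 0) as [->|_]; [|reflexivity].
    exfalso. rewrite cdist_sym in Hw. unfold cdist in Hw.
    replace (z - 0)%C with z in Hw by ring. lra. }
  apply Rnot_lt_le. intros Hlt.
  assert (Hfz := Hmap z0 Hz0). assert (Hz0' := Cmod_ge_0 z0).
  set (x := Cmod z0) in *. set (y := Cmod (f z0)) in *.
  assert (Hz0ne : z0 <> 0).
  { intros E. unfold x, y in *. rewrite E, Hf0, Cmod_0 in Hlt. lra. }
  assert (Hx : 0 < x) by now apply Cmod_gt_0.
  (* A single radius replaces the limit at 1. If [x < y] then [r] lies between [x / y] and 1 and
     exceeds [x]; the bound [1 / r] on the circle gives [y / x <= 1 / r] at [z0], contradicting
     [x / y < r]. *)
  pose (r := (x / y + 1) / 2).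
  assert (Hxy : x < x / y < 1).
  { split.
    - apply Rmult_lt_reg_r with y; [lra|]. unfold Rdiv. rewrite Rmult_assoc, Rinv_l by lra. nra.
    - apply Rmult_lt_reg_r with y; [lra|]. unfold Rdiv. rewrite Rmult_assoc, Rinv_l by lra. lra. }
  assert (Hr : x / y < r < 1) by (unfold r; lra).
  assert (K : Cmod (g z0) <= / r).
  { apply (maximum_principle g r); try lra; try assumption.
    - intros z Hz. apply Hgd. lra.
    - intros z Hz. unfold g. destruct (Ceq_dec z 0) as [E|Hz'].
      { rewrite E, Cmod_0 in Hz. lra. }
      rewrite Cmod_mult, Cmod_inv, Hz by assumption.
      rewrite <- (Rmult_1_l (/ r)) at 2. apply Rmult_le_compat_r.
      + left. apply Rinv_0_lt_compat. lra.
      + left. apply Hmap. lra.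
    - fold x. lra. }
  unfold g in K. destruct (Ceq_dec z0 0) as [E|_]; [easy|].
  rewrite Cmod_mult, Cmod_inv in K by assumption. fold x y in K.
  assert (K2 : y * r <= x).
  { apply Rmult_le_compat_r with (r := r * x) in K; [|nra].
    replace (y * / x * (r * x)) with (y * r) in K by (field; lra).
    replace (/ r * (r * x)) with x in K by (field; lra). assumption. }
  assert (x < y * r).
  { replace x with (y * (x / y)) by (field; lra). apply Rmult_lt_compat_l; lra. }
  lra.
Qed.

(* The factor [1] gives the numerator the shape of [has_cderiv_affine]. *)
Definition moebius (a z : C) : C := ((1 * z + a) * / (Cconj a * z + 1))%C.

(** Positivity of the right-hand side makes [moebius a] a self-map of the disc; later the same
    identity turns differences of Poincare distances into a closed formula. *)
Lemma moebius_identity (a z : C) :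
  Cmod (Cconj a * z + 1)%C ^ 2 - Cmod (z + a)%C ^ 2 = (1 - Cmod a ^ 2) * (1 - Cmod z ^ 2).
Proof. rewrite !Cmod_sqr. destruct a, z. simpl. ring. Qed.

Lemma unit_disc_sqr (a : C) : unit_disc a -> 0 < 1 - Cmod a ^ 2.
Proof. unfold unit_disc. generalize (Cmod_ge_0 a). nra. Qed.

Lemma moebius_denom (a z : C) : unit_disc a -> unit_disc z ->
  Cmod (z + a)%C < Cmod (Cconj a * z + 1)%C.
Proof.
  intros Ha Hz. assert (E := moebius_identity a z).
  assert (P := Rmult_lt_0_compat _ _ (unit_disc_sqr a Ha) (unit_disc_sqr z Hz)).
  generalize (Cmod_ge_0 (z + a)) (Cmod_ge_0 (Cconj a * z + 1)). nra.
Qed.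

Lemma moebius_denom_neq_0 (a z : C) : unit_disc a -> unit_disc z ->
  (Cconj a * z + 1)%C <> 0.
Proof.
  intros Ha Hz. apply Cmod_gt_0.
  generalize (moebius_denom a z Ha Hz) (Cmod_ge_0 (z + a)). lra.
Qed.

Lemma Cmod_moebius (a z : C) : unit_disc a -> unit_disc z ->
  Cmod (moebius a z) = Cmod (z + a)%C / Cmod (Cconj a * z + 1)%C.
Proof.
  intros Ha Hz. unfold moebius. rewrite Cmod_mult, Cmod_inv by now apply moebius_denom_neq_0.
  unfold Rdiv. f_equal. f_equal. ring.
Qed.

Lemma moebius_disc (a z : C) : unit_disc a -> unit_disc z -> unit_disc (moebius a z).
Proof.
  intros Ha Hz. unfold unit_disc. rewrite Cmod_moebius by assumption.
  assert (D := moebius_denom a z Ha Hz). assert (P := Cmod_ge_0 (z + a)).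
  apply Rmult_lt_reg_r with (Cmod (Cconj a * z + 1)%C); [lra|].
  unfold Rdiv. rewrite Rmult_assoc, Rinv_l by lra. lra.
Qed.

Lemma unit_disc_opp (a : C) : unit_disc a -> unit_disc (- a)%C.
Proof. unfold unit_disc. now rewrite Cmod_opp. Qed.

Lemma moebius_cancel (a z : C) : unit_disc a -> unit_disc z ->
  moebius a (moebius (- a)%C z) = z.
Proof.
  intros Ha Hz.
  assert (H1 := moebius_denom_neq_0 _ z (unit_disc_opp a Ha) Hz).
  assert (H2 := moebius_denom_neq_0 a _ Ha (moebius_disc _ z (unit_disc_opp a Ha) Hz)).
  unfold moebius in *.
  assert (Ec : Cconj (- a)%C = (- Cconj a)%C) by (destruct a; reflexivity).
  rewrite Ec in *.
  (* The outer denominator cleared of the inner fraction, the form in which [field] asks for it to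
     be nonzero. *)
  assert (H3 : (Cconj a * (1 * z + - a) + (- Cconj a * z + 1))%C <> 0).
  { intros E. apply H2.
    replace (Cconj a * ((1 * z + - a) * / (- Cconj a * z + 1)) + 1)%C with
      ((Cconj a * (1 * z + - a) + (- Cconj a * z + 1)) / (- Cconj a * z + 1))%C
      by (field; assumption).
    rewrite E. field. assumption. }
  field. split; [assumption|]. now rewrite Cmult_1_l in H3.
Qed.

Lemma moebius_holomorphic (a : C) : unit_disc a -> cholomorphic_disc (moebius a).
Proof.
  intros Ha z Hz. eexists. unfold moebius.
  apply (has_cderiv_mult (fun w => 1 * w + a)%C (fun w => / (Cconj a * w + 1))%C).
  - apply has_cderiv_affine.
  - apply (has_cderiv_comp (fun w => Cconj a * w + 1)%C Cinv); [apply has_cderiv_affine|].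
    apply has_cderiv_inv. now apply moebius_denom_neq_0.
Qed.

Lemma cholomorphic_disc_comp (f g : C -> C) :
  cholomorphic_disc f -> (forall z, unit_disc z -> unit_disc (f z)) ->
  cholomorphic_disc g -> cholomorphic_disc (fun z => g (f z)).
Proof.
  intros Hf Hm Hg z Hz. destruct (Hf z Hz) as [l Hl]. destruct (Hg _ (Hm z Hz)) as [m Hl'].
  eexists. apply has_cderiv_comp; eassumption.
Qed.

(** The pseudohyperbolic distance, of which [poincare] is the inverse hyperbolic tangent. *)
Definition pseudo_dist (a b : C) : R := Cmod (a - b)%C / Cmod (1 - Cconj a * b)%C.

Lemma pseudo_dist_moebius (a b : C) : unit_disc a -> unit_disc b ->
  pseudo_dist a b = Cmod (moebius (- a)%C b).
Proof.
  intros Ha Hb. rewrite Cmod_moebius by (try apply unit_disc_opp; assumption).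
  unfold pseudo_dist. rewrite <- (Cmod_opp (a - b)).
  apply f_equal2; apply f_equal; [ring|].
  destruct a, b. unfold Cminus, Cplus, Copp, Cmult, Cconj; simpl. f_equal; ring.
Qed.

Lemma pseudo_dist_sym (a b : C) : pseudo_dist a b = pseudo_dist b a.
Proof.
  unfold pseudo_dist. rewrite <- (Cmod_opp (a - b)), <- (Cmod_conj (1 - Cconj a * b)).
  apply f_equal2; apply f_equal; [ring|].
  destruct a, b. unfold Cminus, Cplus, Copp, Cmult, Cconj; simpl. f_equal; ring.
Qed.

Lemma pseudo_dist_range (a b : C) : unit_disc a -> unit_disc b ->
  0 <= pseudo_dist a b < 1.
Proof.
  intros Ha Hb. rewrite pseudo_dist_moebius by assumption. split; [apply Cmod_ge_0|].
  apply moebius_disc; [now apply unit_disc_opp|assumption].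
Qed.

(** Moebius maps before and after [f], carrying 0 to [a] and [f a] to 0, reduce the claim to
    [schwarz_lemma]. *)
Lemma schwarz_pick (f : C -> C) (a b : C) :
  cholomorphic_disc f -> (forall z, unit_disc z -> unit_disc (f z)) ->
  unit_disc a -> unit_disc b -> pseudo_dist (f a) (f b) <= pseudo_dist a b.
Proof.
  intros Hf Hm Ha Hb. assert (Hfa := Hm a Ha). assert (Hfb := Hm b Hb).
  rewrite !pseudo_dist_moebius by assumption.
  rewrite <- (moebius_cancel a b Ha Hb) at 1.
  assert (Hb' := moebius_disc _ b (unit_disc_opp a Ha) Hb).
  apply (schwarz_lemma (fun z => moebius (- f a)%C (f (moebius a z)))); [| | |assumption].
  - apply (cholomorphic_disc_comp (fun z => f (moebius a z))).
    + apply cholomorphic_disc_comp; [now apply moebius_holomorphic| |assumption].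
      intros z Hz. now apply moebius_disc.
    + intros z Hz. apply Hm. now apply moebius_disc.
    + apply moebius_holomorphic. now apply unit_disc_opp.
  - intros z Hz. apply moebius_disc; [now apply unit_disc_opp|].
    apply Hm. now apply moebius_disc.
  - replace (moebius a 0) with a.
    + unfold moebius. replace (1 * f a + - f a)%C with (RtoC 0) by ring. apply Cmult_0_l.
    + unfold moebius. replace (Cconj a * 0 + 1)%C with (RtoC 1) by ring. field.
Qed.

(** * The Poincare metric *)

Definition artanh (t : R) : R := / 2 * ln ((1 + t) / (1 - t)).

Lemma poincare_artanh (a b : C) : poincare a b = artanh (pseudo_dist a b).
Proof. reflexivity. Qed.

Lemma artanh_le (s t : R) : 0 <= s -> s <= t -> t < 1 -> artanh s <= artanh t.
Proof.
  intros Hs Hst Ht. unfold artanh. apply Rmult_le_compat_l; [lra|].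
  apply ln_le; [apply Rdiv_lt_0_compat; lra|].
  apply Rmult_le_reg_r with ((1 - s) * (1 - t)); [nra|].
  replace ((1 + s) / (1 - s) * ((1 - s) * (1 - t))) with ((1 + s) * (1 - t)) by (field; lra).
  replace ((1 + t) / (1 - t) * ((1 - s) * (1 - t))) with ((1 + t) * (1 - s)) by (field; lra).
  nra.
Qed.

Lemma artanh_plus (s t : R) : 0 <= s < 1 -> 0 <= t < 1 ->
  artanh s + artanh t = artanh ((s + t) / (1 + s * t)).
Proof.
  intros Hs Ht. unfold artanh. rewrite <- Rmult_plus_distr_l, <- ln_mult
    by (apply Rdiv_lt_0_compat; lra).
  f_equal. f_equal. field. repeat split; nra.
Qed.

(** The triangle inequality through 0, in the shape given by [artanh_plus]. By [moebius_identity]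
    the complement to 1 of the left side squared is [(1 - |a|^2)(1 - |b|^2) / N^2] with
    [N <= 1 + |a||b|]; for the right side the denominator is [(1 + |a||b|)^2]. *)
Lemma pseudo_dist_le_sum (a b : C) : unit_disc a -> unit_disc b ->
  pseudo_dist a b <= (Cmod a + Cmod b) / (1 + Cmod a * Cmod b).
Proof.
  intros Ha Hb. assert (E := moebius_identity (- a)%C b).
  assert (D := moebius_denom _ b (unit_disc_opp a Ha) Hb).
  rewrite pseudo_dist_moebius, Cmod_moebius by (try apply unit_disc_opp; assumption).
  assert (T : Cmod (Cconj (- a)%C * b + 1) <= 1 + Cmod a * Cmod b).
  { eapply Rle_trans; [apply Cmod_triangle|].
    rewrite Cmod_mult, Cmod_conj, Cmod_opp, Cmod_1. lra. }
  assert (P := Rmult_lt_0_compat _ _ (unit_disc_sqr a Ha) (unit_disc_sqr b Hb)).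
  assert (X := Cmod_ge_0 a). assert (Y := Cmod_ge_0 b).
  assert (n0 := Cmod_ge_0 (b + - a)). rewrite Cmod_opp in E.
  set (n := Cmod (b + - a)%C) in *. set (N := Cmod (Cconj (- a)%C * b + 1)) in *.
  set (x := Cmod a) in *. set (y := Cmod b) in *.
  assert (H1 : 0 < 1 + x * y) by nra.
  assert (S2 : (n * (1 + x * y)) ^ 2 <= ((x + y) * N) ^ 2).
  { replace ((n * (1 + x * y)) ^ 2) with
      ((N ^ 2 - (1 - x ^ 2) * (1 - y ^ 2)) * (1 + x * y) ^ 2) by (rewrite <- E; ring).
    replace (((x + y) * N) ^ 2) with
      (((1 + x * y) ^ 2 - (1 - x ^ 2) * (1 - y ^ 2)) * N ^ 2) by ring.
    assert (N ^ 2 <= (1 + x * y) ^ 2) by (apply pow_incr; lra).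
    assert ((1 - x ^ 2) * (1 - y ^ 2) * N ^ 2 <= (1 - x ^ 2) * (1 - y ^ 2) * (1 + x * y) ^ 2)
      by (apply Rmult_le_compat_l; lra).
    lra. }
  assert (S1 : n * (1 + x * y) <= (x + y) * N).
  { apply Rnot_lt_le. intros K. apply (Rle_not_lt _ _ S2).
    assert (0 <= (x + y) * N) by (apply Rmult_le_pos; lra). nra. }
  apply Rmult_le_reg_r with (N * (1 + x * y)); [apply Rmult_lt_0_compat; lra|].
  replace (n / N * (N * (1 + x * y))) with (n * (1 + x * y)) by (field; lra).
  replace ((x + y) / (1 + x * y) * (N * (1 + x * y))) with ((x + y) * N) by (field; lra).
  assumption.
Qed.

Lemma poincare_refl (a : C) : poincare a a = 0.
Proof.
  rewrite poincare_artanh. unfold pseudo_dist, artanh.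
  replace (a - a)%C with (RtoC 0) by ring. rewrite Cmod_0. unfold Rdiv at 2 3.
  rewrite Rmult_0_l, Rplus_0_r, Rminus_0_r. unfold Rdiv. rewrite Rinv_1, Rmult_1_r, ln_1. ring.
Qed.

(** Moving [b] to the centre reduces this to [pseudo_dist_le_sum]; Schwarz-Pick for the Moebius map
    moving it back compares the distances of [a] and [c]. *)
Lemma poincare_triangle (a b c : C) : unit_disc a -> unit_disc b -> unit_disc c ->
  poincare a c <= poincare a b + poincare b c.
Proof.
  intros Ha Hb Hc. rewrite !poincare_artanh.
  rewrite artanh_plus by now apply pseudo_dist_range.
  rewrite (pseudo_dist_sym a b), !(pseudo_dist_moebius b) by assumption.
  assert (Hb' := unit_disc_opp b Hb).
  assert (Ha' := moebius_disc _ a Hb' Ha). assert (Hc' := moebius_disc _ c Hb' Hc).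
  assert (Xa := Cmod_ge_0 (moebius (- b)%C a)). assert (Xc := Cmod_ge_0 (moebius (- b)%C c)).
  apply artanh_le.
  - now apply pseudo_dist_range.
  - eapply Rle_trans; [|now apply pseudo_dist_le_sum].
    rewrite <- (moebius_cancel b a Hb Ha) at 1. rewrite <- (moebius_cancel b c Hb Hc) at 1.
    apply schwarz_pick; try assumption.
    + now apply moebius_holomorphic.
    + intros z Hz. now apply moebius_disc.
  - unfold unit_disc in *. apply Rmult_lt_reg_r with (1 + Cmod (moebius (- b)%C a) * Cmod (moebius (- b)%C c)).
    + nra.
    + unfold Rdiv. rewrite Rmult_assoc, Rinv_l by nra. nra.
Qed.

(** Each disc of a chain followed by the inverse of [psi] is a self-map of the disc, so Schwarz-Pick
    and the triangle inequality bound every chain from below. The chain with [psi] as its only disc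
    attains the bound. *)
Lemma kobayashi_biholomorphism (Omega : cset) (psi : C -> C) (a b : C) :
  biholomorphism unit_disc Omega psi -> unit_disc a -> unit_disc b ->
  kobayashi Omega (psi a) (psi b) = poincare a b.
Proof.
  intros [Hhol [Hmap [Hinj [phi [Hphol Hphi]]]]] Ha Hb.
  assert (Hpp : forall z, unit_disc z -> phi (psi z) = z).
  { intros z Hz. destruct (Hphi (psi z) (Hmap z Hz)) as [H1 H2]. now apply Hinj. }
  unfold kobayashi.
  rewrite (is_glb_Rbar_unique _ (Finite (poincare a b))); [reflexivity|]. split.
  - intros s [n [p [f [al [be [H0 [Hn [Hch ->]]]]]]]]. simpl.
    (* Membership in [Omega] is carried along because [phi] is controlled only there. *)
    assert (K : forall m, (m <= n)%nat -> Omega (p m) /\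
       poincare a (phi (p m)) <= sumR m (fun j => poincare (al j) (be j))).
    { induction m as [|m IH]; intros Hm.
      - rewrite H0, Hpp, poincare_refl by assumption. split; [now apply Hmap|simpl; lra].
      - destruct IH as [IH1 IH2]; [lia|].
        destruct (Hch m) as [F1 [F2 [F3 [F4 [F5 F6]]]]]; [lia|].
        assert (HO : Omega (p (S m))) by (rewrite <- F6; now apply F2).
        split; [assumption|].
        assert (SP : poincare (phi (p m)) (phi (p (S m))) <= poincare (al m) (be m)).
        { rewrite !poincare_artanh. apply artanh_le.
          - apply pseudo_dist_range; now apply Hphi.
          - rewrite <- F5, <- F6.
            apply (schwarz_pick (fun z => phi (f m z))); try assumption.
            + intros z Hz.
              destruct (has_cderiv_of_differentiable _ _ (F1 z Hz)) as [l Hl].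
              destruct (has_cderiv_of_differentiable _ _ (Hphol _ (F2 z Hz))) as [l' Hl'].
              eexists. apply has_cderiv_comp; eassumption.
            + intros z Hz. apply Hphi. now apply F2.
          - now apply pseudo_dist_range. }
        assert (T := poincare_triangle a (phi (p m)) (phi (p (S m))) Ha
          (proj1 (Hphi _ IH1)) (proj1 (Hphi _ HO))).
        simpl. lra. }
    destruct (K n (le_n _)) as [_ K']. now rewrite Hn, Hpp in K'.
  - intros l Hl. apply Hl.
    exists 1%nat, (fun j => match j with O => psi a | _ => psi b end),
      (fun _ => psi), (fun _ => a), (fun _ => b).
    repeat split; try assumption.
    + destruct j; [reflexivity|lia].
    + simpl. ring.
Qed.

(** * Horospheres and horodiscs *)

(** With [N = |1 - conj z w|] and [n = |z - w|], write [(N + n) / (N - n)] as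
    [(N + n)^2 / (N^2 - n^2)]. By [moebius_identity] the denominator contains [1 - |w|^2], whose
    vanishing factor cancels against the distance from 0, leaving an expression regular at
    [|w| = 1]. *)
Lemma poincare_sub (z w : C) : unit_disc z -> unit_disc w ->
  poincare z w - poincare 0 w =
  / 2 * ln ((Cmod (1 - Cconj z * w)%C + cdist z w) ^ 2 /
            ((1 - Cmod z ^ 2) * (1 + Cmod w) ^ 2)).
Proof.
  intros Hz Hw. assert (E := moebius_identity (- z)%C w).
  assert (D := moebius_denom _ w (unit_disc_opp z Hz) Hw).
  assert (P1 := unit_disc_sqr z Hz). assert (P2 := unit_disc_sqr w Hw).
  rewrite Cmod_opp in E. unfold poincare.
  replace (0 - w)%C with (- w)%C by ring. rewrite Cmod_opp.
  replace (1 - Cconj 0 * w)%C with (RtoC 1).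
  2:{ destruct w. unfold Cminus, Cplus, Copp, Cmult, Cconj, RtoC; simpl. f_equal; ring. }
  rewrite Cmod_1. unfold cdist.
  replace (Cmod (w + - z)%C) with (Cmod (z - w)%C) in *
    by (rewrite <- Cmod_opp; f_equal; ring).
  replace (Cconj (- z)%C * w + 1)%C with (1 - Cconj z * w)%C in *
    by (destruct z, w; unfold Cminus, Cplus, Copp, Cmult, Cconj; simpl; f_equal; ring).
  assert (n0 := Cmod_ge_0 (z - w)). assert (w0 := Cmod_ge_0 w). unfold unit_disc in Hw.
  set (n := Cmod (z - w)%C) in *. set (N := Cmod (1 - Cconj z * w)%C) in *.
  rewrite <- Rmult_minus_distr_l. f_equal.
  rewrite <- ln_div.
  - f_equal.
    replace (1 - Cmod z ^ 2) with ((N ^ 2 - n ^ 2) / (1 - Cmod w ^ 2))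
      by (rewrite E; field; lra).
    field. repeat split; try nra.
  - apply Rdiv_lt_0_compat.
    + assert (0 <= n / N) by (apply Rmult_le_pos; [lra|left; apply Rinv_0_lt_compat; lra]). lra.
    + apply Rmult_lt_reg_r with N; [lra|].
      replace ((1 - n / N) * N) with (N - n) by (field; lra). lra.
  - apply Rdiv_lt_0_compat; lra.
Qed.

(** In the formula of [poincare_sub], the numerator is at least [(2 |z - w|)^2] and [(1 + |w|)^2] is
    at most 4, for every [w] and not only in the limit. *)
Lemma poincare_sub_lower (z w : C) (c : R) : unit_disc z -> unit_disc w ->
  poincare z w - poincare 0 w <= c -> cdist z w ^ 2 <= exp (2 * c) * (1 - Cmod z ^ 2).
Proof.
  intros Hz Hw H. rewrite poincare_sub in H by assumption.
  assert (D := moebius_denom _ w (unit_disc_opp z Hz) Hw).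
  assert (P1 := unit_disc_sqr z Hz). assert (w0 := Cmod_ge_0 w).
  replace (Cmod (w + - z)%C) with (cdist z w) in D
    by (unfold cdist; rewrite <- Cmod_opp; f_equal; ring).
  replace (Cconj (- z)%C * w + 1)%C with (1 - Cconj z * w)%C in D
    by (destruct z, w; unfold Cminus, Cplus, Copp, Cmult, Cconj; simpl; f_equal; ring).
  assert (n0 : 0 <= cdist z w) by apply Cmod_ge_0. unfold unit_disc in Hw.
  set (n := cdist z w) in *. set (N := Cmod (1 - Cconj z * w)%C) in *.
  set (Q := (N + n) ^ 2 / ((1 - Cmod z ^ 2) * (1 + Cmod w) ^ 2)) in *.
  assert (Hd : 0 < (1 - Cmod z ^ 2) * (1 + Cmod w) ^ 2)
    by (apply Rmult_lt_0_compat; [assumption|apply pow_lt; lra]).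
  assert (HQ : 0 < Q) by (apply Rdiv_lt_0_compat; [apply pow_lt; lra|assumption]).
  assert (HQc : Q <= exp (2 * c)).
  { rewrite <- (exp_ln Q HQ). destruct (Req_dec (ln Q) (2 * c)) as [->|]; [lra|].
    left. apply exp_increasing. lra. }
  assert (HQn : n ^ 2 <= Q * (1 - Cmod z ^ 2)).
  { apply Rmult_le_reg_r with ((1 + Cmod w) ^ 2); [apply pow_lt; lra|].
    replace (Q * (1 - Cmod z ^ 2) * (1 + Cmod w) ^ 2) with ((N + n) ^ 2)
      by (unfold Q; field; lra).
    rewrite <- Rpow_mult_distr. apply pow_incr. split; nra. }
  eapply Rle_trans; [exact HQn|]. apply Rmult_le_compat_r; lra.
Qed.

(** Strictness leaves room for a [q] between [|z - s|^2 / (1 - |z|^2)] and [Rr]; the bound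
    [ln q / 2] then holds uniformly near [s]. *)
Lemma poincare_sub_upper (z s : C) (Rr : R) : unit_disc z -> Cmod s = 1 -> 0 < Rr ->
  cdist z s ^ 2 < Rr * (1 - Cmod z ^ 2) ->
  exists delta c, 0 < delta /\ c < / 2 * ln Rr /\ forall w, unit_disc w ->
    cdist w s < delta -> poincare z w - poincare 0 w <= c.
Proof.
  intros Hz Hs HR H. assert (P1 := unit_disc_sqr z Hz).
  set (k := 1 - Cmod z ^ 2) in *. assert (x0 : 0 <= cdist z s) by apply Cmod_ge_0.
  set (x := cdist z s) in *.
  assert (Hx2 : x <= 2).
  { unfold x, cdist. replace (z - s)%C with (z + - s)%C by ring.
    eapply Rle_trans; [apply Cmod_triangle|]. rewrite Cmod_opp, Hs. unfold unit_disc in Hz. lra. }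
  pose (q := (x ^ 2 / k + Rr) / 2).
  assert (Hq0 : x ^ 2 / k < Rr).
  { apply Rmult_lt_reg_r with k; [assumption|].
    replace (x ^ 2 / k * k) with (x ^ 2) by (field; lra). assumption. }
  assert (Hq1 : 0 <= x ^ 2 / k) by (apply Rmult_le_pos; [nra|left; now apply Rinv_0_lt_compat]).
  assert (Hq : 0 < q < Rr) by (unfold q; lra).
  assert (Hqk : x ^ 2 < q * k).
  { replace (x ^ 2) with (x ^ 2 / k * k) by (field; lra).
    apply Rmult_lt_compat_r; [assumption|unfold q; lra]. }
  clearbody q.
  assert (Hqk0 : 0 < q * k) by (apply Rmult_lt_0_compat; lra).
  (* The aim is [(2 (x + e))^2 <= q k (2 - e)^2] for [e <= d]. As [x <= 2] and [e <= 1], the left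
     side is at most [4 x^2 + 20 e] and the right side at least [4 q k - 4 q k e]. *)
  pose (d := Rmin 1 (4 * (q * k - x ^ 2) / (20 + 4 * (q * k)))).
  assert (Hd1 : d <= 1) by apply Rmin_l.
  assert (Hd2 : d * (20 + 4 * (q * k)) <= 4 * (q * k - x ^ 2)).
  { apply Rle_trans with (4 * (q * k - x ^ 2) / (20 + 4 * (q * k)) * (20 + 4 * (q * k))).
    - apply Rmult_le_compat_r; [lra|apply Rmin_r].
    - right. field. lra. }
  exists d, (/ 2 * ln q). split; [|split].
  - apply Rmin_pos; [lra|apply Rdiv_lt_0_compat; lra].
  - apply Rmult_lt_compat_l; [lra|]. apply ln_increasing; lra.
  - clearbody d. intros w Hw Hws. rewrite poincare_sub by assumption.
    assert (e0 : 0 <= cdist w s) by apply Cmod_ge_0.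
    set (e := cdist w s) in *.
    assert (T1 : cdist z w <= x + e).
    { unfold x, e. rewrite (cdist_sym w s). apply cdist_triangle. }
    (* [|1 - conj z * s| = |s - z|] since [|s| = 1]. *)
    assert (T2 : Cmod (1 - Cconj z * w)%C <= x + e).
    { replace (1 - Cconj z * w)%C with ((1 - Cconj z * s) + Cconj z * (s - w))%C by ring.
      eapply Rle_trans; [apply Cmod_triangle|].
      assert (E1 : Cmod (1 - Cconj z * s)%C = x).
      { replace (1 - Cconj z * s)%C with (s * Cconj (s - z))%C.
        - rewrite Cmod_mult, Cmod_conj, Hs, Rmult_1_l. unfold x. now rewrite cdist_sym.
        - replace (RtoC 1) with (s * Cconj s)%C.
          + destruct s, z. unfold Cminus, Cplus, Copp, Cmult, Cconj; simpl. f_equal; ring.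
          + rewrite <- Cmod2_conj, Hs. f_equal. ring. }
      rewrite E1, Cmod_mult, Cmod_conj. unfold e. rewrite cdist_sym. unfold cdist.
      assert (Cmod z * Cmod (s - w)%C <= 1 * Cmod (s - w)%C).
      { apply Rmult_le_compat_r; [apply Cmod_ge_0|]. unfold unit_disc in Hz. lra. }
      lra. }
    assert (T3 : 2 - e <= 1 + Cmod w).
    { generalize (Cmod_triangle_inv s w). rewrite cdist_sym, Hs. fold e. lra. }
    assert (D := moebius_denom _ w (unit_disc_opp z Hz) Hw).
    replace (Cconj (- z)%C * w + 1)%C with (1 - Cconj z * w)%C in D
      by (destruct z, w; unfold Cminus, Cplus, Copp, Cmult, Cconj; simpl; f_equal; ring).
    assert (D0 := Cmod_ge_0 (w + - z)).
    assert (n0 : 0 <= cdist z w) by apply Cmod_ge_0.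
    set (n := cdist z w) in *. set (N := Cmod (1 - Cconj z * w)%C) in *. fold k.
    assert (Hden : 0 < (1 + Cmod w) ^ 2) by (apply pow_lt; lra).
    apply Rmult_le_compat_l; [lra|]. apply ln_le.
    { apply Rdiv_lt_0_compat; [apply pow_lt; lra|apply Rmult_lt_0_compat; assumption]. }
    apply Rmult_le_reg_r with (k * (1 + Cmod w) ^ 2); [now apply Rmult_lt_0_compat|].
    replace ((N + n) ^ 2 / (k * (1 + Cmod w) ^ 2) * (k * (1 + Cmod w) ^ 2))
      with ((N + n) ^ 2) by (field; lra).
    apply Rle_trans with ((2 * (x + e)) ^ 2); [apply pow_incr; lra|].
    apply Rle_trans with (q * k * (2 - e) ^ 2).
    + assert (e * (20 + 4 * (q * k)) <= d * (20 + 4 * (q * k)))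
        by (apply Rmult_le_compat_r; lra).
      nra.
    + rewrite <- Rmult_assoc. apply Rmult_le_compat_l; [lra|]. apply pow_incr. lra.
Qed.

(** * Boundary behaviour of the inverse Riemann map *)

Lemma accumulation_point_eps (Q : R -> C -> Prop) (M : R) :
  (forall d d' z, d <= d' -> Q d z -> Q d' z) ->
  (forall d, 0 < d -> exists z, Q d z /\ Cmod z <= M) ->
  exists z0, forall d, 0 < d -> exists z, Q d z /\ cdist z z0 < d.
Proof.
  intros Hmono HQ.
  destruct (accumulation_point (fun n z => Q (/ INR (S n)) z) M) as [z0 Hz0].
  { intros n. apply HQ. apply Rinv_0_lt_compat, lt_0_INR. lia. }
  exists z0. intros d Hd. destruct (archimed_cor1 d Hd) as [N [HN HN0]].
  destruct (Hz0 d Hd N) as [n [z [Hn [Hq Hz]]]]. exists z. split; [|assumption].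
  apply (Hmono (/ INR (S n))); [|assumption]. left. eapply Rle_lt_trans; [|exact HN].
  apply Rinv_le_contravar; [now apply lt_0_INR|apply le_INR; lia].
Qed.

(** All that the boundary argument uses of the Riemann map: mutually inverse, continuous, and an
    isometry for the two distances. Differentiability does not appear beyond this interface. *)
Definition disc_chart (Omega : cset) (psi phi : C -> C) : Prop :=
  (forall z, unit_disc z -> Omega (psi z) /\ phi (psi z) = z /\ ccontinuous psi z) /\
  (forall w, Omega w -> unit_disc (phi w) /\ psi (phi w) = w /\ ccontinuous phi w) /\
  (forall a b, unit_disc a -> unit_disc b ->
     kobayashi Omega (psi a) (psi b) = poincare a b).

Definition boundary_limit (Omega : cset) (phi : C -> C) (x s : C) : Prop :=
  forall eps, 0 < eps -> exists delta, 0 < delta /\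
    forall w, Omega w -> cdist w x < delta -> cdist (phi w) s < eps.

Definition clusters (Omega : cset) (phi : C -> C) (x s : C) : Prop :=
  forall eps, 0 < eps -> exists w, Omega w /\ cdist w x < eps /\ cdist (phi w) s < eps.

Lemma biholomorphism_disc_chart (Omega : cset) (psi : C -> C) :
  biholomorphism unit_disc Omega psi -> exists phi, disc_chart Omega psi phi.
Proof.
  intros H. assert (H' := H). destruct H as [Hhol [Hmap [Hinj [phi [Hphol Hphi]]]]].
  exists phi. split; [|split].
  - intros z Hz. split; [now apply Hmap|]. split.
    + destruct (Hphi (psi z) (Hmap z Hz)). now apply Hinj.
    + destruct (has_cderiv_of_differentiable _ _ (Hhol z Hz)) as [l Hl].
      now apply has_cderiv_continuous with l.
  - intros w Hw. destruct (Hphi w Hw) as [H1 H2]. repeat split; try assumption.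
    destruct (has_cderiv_of_differentiable _ _ (Hphol w Hw)) as [l Hl].
    now apply has_cderiv_continuous with l.
  - intros a b. now apply kobayashi_biholomorphism.
Qed.

Lemma cdist_small_eq (z w : C) : (forall eps, 0 < eps -> cdist z w < eps) -> z = w.
Proof.
  intros H. apply cdist_eq_0. apply Rnot_lt_le. intros K. specialize (H _ K). lra.
Qed.

Lemma boundary_limit_clusters (Omega : cset) (phi : C -> C) (x s : C) :
  c_closure Omega x -> boundary_limit Omega phi x s -> clusters Omega phi x s.
Proof.
  intros Hx H eps Heps. destruct (H eps Heps) as [d [Hd K]].
  destruct (Hx (Rmin d eps)) as [w [Hw Hwx]]; [now apply Rmin_pos|].
  exists w. split; [assumption|]. split.
  - eapply Rlt_le_trans; [exact Hwx|apply Rmin_r].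
  - apply K; [assumption|]. eapply Rlt_le_trans; [exact Hwx|apply Rmin_l].
Qed.

Lemma boundary_limit_unique (Omega : cset) (phi : C -> C) (x s t : C) :
  boundary_limit Omega phi x s -> clusters Omega phi x t -> s = t.
Proof.
  intros Hs Ht. apply cdist_small_eq. intros eps Heps.
  destruct (Hs (eps / 2)) as [d [Hd K]]; [lra|].
  destruct (Ht (Rmin d (eps / 2))) as [w [Hw [W1 W2]]]; [apply Rmin_pos; lra|].
  specialize (K w Hw (Rlt_le_trans _ _ _ W1 (Rmin_l _ _))).
  assert (W3 := Rlt_le_trans _ _ _ W2 (Rmin_r _ _)).
  generalize (cdist_triangle s (phi w) t). rewrite (cdist_sym s (phi w)). lra.
Qed.

(** If [s] were inside the disc, continuity of [psi] at [s] would give [psi s = x] and put [x] in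
    [Omega]. *)
Lemma clusters_Cmod (Omega : cset) (psi phi : C -> C) (x s : C) :
  disc_chart Omega psi phi -> ~ Omega x -> clusters Omega phi x s -> Cmod s = 1.
Proof.
  intros [Hpsi [Hphi _]] Hx Hs. apply Rle_antisym.
  - apply Rnot_lt_le. intros K. destruct (Hs (Cmod s - 1)) as [w [Hw [_ W]]]; [lra|].
    destruct (Hphi w Hw) as [D _]. unfold unit_disc in D.
    generalize (Cmod_triangle_inv s (phi w)). rewrite cdist_sym. lra.
  - apply Rnot_lt_le. intros K. destruct (Hpsi s K) as [Ho [_ Hc]].
    apply Hx. replace x with (psi s); [assumption|]. apply cdist_small_eq.
    intros eps Heps. destruct (Hc (eps / 2)) as [d [Hd L]]; [lra|].
    destruct (Hs (Rmin d (eps / 2))) as [w [Hw [W1 W2]]]; [apply Rmin_pos; lra|].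
    specialize (L (phi w) (Rlt_le_trans _ _ _ W2 (Rmin_l _ _))).
    destruct (Hphi w Hw) as [_ [E _]]. rewrite E in L.
    assert (W3 := Rlt_le_trans _ _ _ W1 (Rmin_r _ _)).
    generalize (cdist_triangle (psi s) w x). rewrite (cdist_sym (psi s) w). lra.
Qed.

Lemma clusters_inhabited (Omega : cset) (psi phi : C -> C) (x : C) :
  disc_chart Omega psi phi -> c_closure Omega x -> exists s, clusters Omega phi x s.
Proof.
  intros [Hpsi [Hphi _]] Hx.
  destruct (accumulation_point_eps (fun d z => unit_disc z /\ cdist (psi z) x < d) 1)
    as [s Hs].
  - intros d d' z Hdd [H1 H2]. split; [assumption|lra].
  - intros d Hd. destruct (Hx d Hd) as [w [Hw W]]. destruct (Hphi w Hw) as [D [E _]].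
    exists (phi w). rewrite E. unfold unit_disc in *. repeat split; lra.
  - exists s. intros eps Heps. destruct (Hs eps Heps) as [z [[D Hz] Hzs]].
    destruct (Hpsi z D) as [Ho [E _]]. exists (psi z). now rewrite E.
Qed.

(** The images of points on the radius to [s] accumulate because [Omega] is bounded. The
    accumulation point is not in [Omega], where continuity of [phi] would force [s] into the open
    disc. *)
Lemma boundary_point_clustering (Omega : cset) (psi phi : C -> C) (s : C) :
  disc_chart Omega psi phi -> c_bounded Omega -> Cmod s = 1 ->
  exists x, c_boundary Omega x /\ clusters Omega phi x s.
Proof.
  intros [Hpsi [Hphi _]] [M HM] Hs.
  destruct (accumulation_point_eps (fun d w => Omega w /\ cdist (phi w) s < d) M) as [x Hx].
  - intros d d' w Hdd [H1 H2]. split; [assumption|lra].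
  - intros d Hd. pose (t := 1 - Rmin (d / 2) (1 / 2)).
    assert (T1 := Rmin_l (d / 2) (1 / 2)). assert (T2 := Rmin_r (d / 2) (1 / 2)).
    assert (T3 : 0 < Rmin (d / 2) (1 / 2)) by (apply Rmin_pos; lra).
    assert (D : unit_disc (t * s)%C).
    { unfold unit_disc. rewrite Cmod_mult, Cmod_R, Hs, Rabs_pos_eq; unfold t; lra. }
    destruct (Hpsi _ D) as [Ho [E _]]. exists (psi (t * s)%C). rewrite E.
    split; [|now apply HM]. split; [assumption|].
    unfold cdist. replace (t * s - s)%C with (RtoC (t - 1) * s)%C by (rewrite RtoC_minus; ring).
    rewrite Cmod_mult, Hs, Cmod_R, Rabs_left1; unfold t; lra.
  - exists x. assert (Hcl : clusters Omega phi x s).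
    { intros eps Heps. destruct (Hx eps Heps) as [w [[Hw W1] W2]]. now exists w. }
    split; [|assumption]. split.
    + intros r Hr. destruct (Hcl r Hr) as [w [Hw [W _]]]. now exists w.
    + intros Ho. destruct (Hphi x Ho) as [D [_ Hc]].
      assert (L : boundary_limit Omega phi x (phi x)).
      { intros eps Heps. destruct (Hc eps Heps) as [d [Hd K]].
        exists d. split; [assumption|]. intros w _. apply K. }
      rewrite (boundary_limit_unique _ _ _ _ _ L Hcl) in D. unfold unit_disc in D. lra.
Qed.

(** Values of [phi] staying away from [s] would accumulate in the closed disc at a second cluster
    point. *)
Lemma boundary_limit_of_unique_cluster (Omega : cset) (psi phi : C -> C) (x s : C) :
  disc_chart Omega psi phi -> (forall t, clusters Omega phi x t -> t = s) ->
  boundary_limit Omega phi x s.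
Proof.
  intros [Hpsi [Hphi _]] Hu eps Heps. apply NNPP. intros Hno.
  destruct (accumulation_point_eps
    (fun d z => unit_disc z /\ cdist (psi z) x < d /\ eps <= cdist z s) 1) as [t Ht].
  - intros d d' z Hdd [H1 [H2 H3]]. repeat split; try assumption. lra.
  - intros d Hd. apply NNPP. intros H. apply Hno. exists d. split; [assumption|].
    intros w Hw W. apply Rnot_le_lt. intros K. apply H.
    destruct (Hphi w Hw) as [D [E _]]. exists (phi w). rewrite E.
    unfold unit_disc in *. repeat split; try assumption; lra.
  - assert (E : t = s).
    { apply Hu. intros e He. destruct (Ht e He) as [z [[D [Hz _]] Hzt]].
      destruct (Hpsi z D) as [Ho [E _]]. exists (psi z). now rewrite E. }
    subst t. destruct (Ht eps Heps) as [z [[_ [_ K]] Hz]]. lra.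
Qed.

Lemma exp_double_half_ln (r : R) : 0 < r -> exp (2 * (/ 2 * ln r)) = r.
Proof. intros Hr. replace (2 * (/ 2 * ln r)) with (ln r) by field. now apply exp_ln. Qed.

Lemma exp_double_lt (c r : R) : 0 < r -> c < / 2 * ln r -> exp (2 * c) < r.
Proof.
  intros Hr Hc. rewrite <- (exp_double_half_ln r Hr). apply exp_increasing. lra.
Qed.

(** * Horospheres as images of horodiscs *)

Lemma small_horosphere_clusters (Omega : cset) (psi phi : C -> C) (x s z : C) (Rr : R) :
  disc_chart Omega psi phi -> 0 < Rr -> unit_disc z -> clusters Omega phi x s ->
  small_horosphere Omega (psi 0) x Rr (psi z) ->
  cdist z s ^ 2 <= Rr * (1 - Cmod z ^ 2).
Proof.
  intros [Hpsi [Hphi Hk]] HR Hz Hs [_ [d [c [Hd [Hc H]]]]].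
  assert (P := unit_disc_sqr z Hz).
  apply Rle_trans with (exp (2 * c) * (1 - Cmod z ^ 2)).
  2:{ apply Rmult_le_compat_r; [lra|]. left. now apply exp_double_lt. }
  apply Rnot_lt_le. intros K.
  destruct (sqr_continuous_eps (cdist z s) (cdist z s)
    (cdist z s ^ 2 - exp (2 * c) * (1 - Cmod z ^ 2))) as [e [He L]].
  { split; [apply Cmod_ge_0|lra]. }
  { lra. }
  destruct (Hs (Rmin d e)) as [w [Hw [W1 W2]]]; [now apply Rmin_pos|].
  specialize (H w Hw (Rlt_le_trans _ _ _ W1 (Rmin_l _ _))).
  destruct (Hphi w Hw) as [D [E _]].
  assert (D0 : unit_disc 0) by (unfold unit_disc; rewrite Cmod_0; lra).
  rewrite <- E, !Hk in H by assumption.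
  apply poincare_sub_lower in H; [|assumption|assumption].
  specialize (L (cdist z (phi w)) (Cmod_ge_0 _)).
  assert (W3 := Rlt_le_trans _ _ _ W2 (Rmin_r _ _)).
  assert (T1 := cdist_triangle z (phi w) s). assert (T2 := cdist_triangle z s (phi w)).
  rewrite (cdist_sym s (phi w)) in T2.
  assert (B : Rabs (cdist z (phi w) - cdist z s) < e) by (apply Rabs_lt_between; lra).
  specialize (L B). apply Rabs_lt_between in L. lra.
Qed.

(** The liminf controls only some points [w] near [x], chosen beyond our control; the full limit of
    [phi] guarantees that their images still approach [s]. *)
Lemma big_horosphere_limit (Omega : cset) (psi phi : C -> C) (x s z : C) (Rr : R) :
  disc_chart Omega psi phi -> 0 < Rr -> unit_disc z -> boundary_limit Omega phi x s ->
  big_horosphere Omega (psi 0) x Rr (psi z) ->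
  cdist z s ^ 2 < Rr * (1 - Cmod z ^ 2).
Proof.
  intros [Hpsi [Hphi Hk]] HR Hz Hs [_ [c [Hc H]]].
  assert (P := unit_disc_sqr z Hz).
  apply Rle_lt_trans with (exp (2 * c) * (1 - Cmod z ^ 2)).
  2:{ apply Rmult_lt_compat_r; [lra|]. now apply exp_double_lt. }
  apply Rnot_lt_le. intros K.
  destruct (sqr_continuous_eps (cdist z s) (cdist z s)
    (cdist z s ^ 2 - exp (2 * c) * (1 - Cmod z ^ 2))) as [e [He L]].
  { split; [apply Cmod_ge_0|lra]. }
  { lra. }
  destruct (Hs e He) as [d [Hd Hs']].
  destruct (H d Hd) as [w [Hw [W1 W2]]].
  specialize (Hs' w Hw W1).
  destruct (Hphi w Hw) as [D [E _]].
  assert (D0 : unit_disc 0) by (unfold unit_disc; rewrite Cmod_0; lra).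
  rewrite <- E, !Hk in W2 by assumption.
  apply poincare_sub_lower in W2; [|assumption|assumption].
  specialize (L (cdist z (phi w)) (Cmod_ge_0 _)).
  assert (T1 := cdist_triangle z (phi w) s). assert (T2 := cdist_triangle z s (phi w)).
  rewrite (cdist_sym s (phi w)) in T2.
  assert (B : Rabs (cdist z (phi w) - cdist z s) < e) by (apply Rabs_lt_between; lra).
  specialize (L B). apply Rabs_lt_between in L. lra.
Qed.

Lemma small_horosphere_limit (Omega : cset) (psi phi : C -> C) (x s z : C) (Rr : R) :
  disc_chart Omega psi phi -> 0 < Rr -> unit_disc z -> Cmod s = 1 ->
  boundary_limit Omega phi x s ->
  cdist z s ^ 2 < Rr * (1 - Cmod z ^ 2) ->
  small_horosphere Omega (psi 0) x Rr (psi z).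
Proof.
  intros [Hpsi [Hphi Hk]] HR Hz Hs1 Hs H. split; [now apply Hpsi|].
  destruct (poincare_sub_upper z s Rr Hz Hs1 HR H) as [e [c [He [Hc K]]]].
  destruct (Hs e He) as [d [Hd Hs']].
  exists d, c. repeat split; try assumption. intros w Hw W.
  destruct (Hphi w Hw) as [D [E _]].
  assert (D0 : unit_disc 0) by (unfold unit_disc; rewrite Cmod_0; lra).
  rewrite <- E, !Hk by assumption. apply K; [assumption|]. now apply Hs'.
Qed.

Lemma small_sub_big_horosphere (Omega : cset) (o x z : C) (Rr : R) :
  c_closure Omega x -> small_horosphere Omega o x Rr z -> big_horosphere Omega o x Rr z.
Proof.
  intros Hx [Hz [d [c [Hd [Hc H]]]]]. split; [assumption|].
  exists c. split; [assumption|]. intros e He.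
  destruct (Hx (Rmin d e)) as [w [Hw W]]; [now apply Rmin_pos|].
  exists w. split; [assumption|]. split.
  - eapply Rlt_le_trans; [exact W|apply Rmin_r].
  - apply H; [assumption|]. eapply Rlt_le_trans; [exact W|apply Rmin_l].
Qed.

Lemma c_closure_subset (A : cset) (x : C) : A x -> c_closure A x.
Proof. intros H r Hr. exists x. now rewrite cdist_refl. Qed.

Lemma c_closure_cases (A : cset) (x : C) : c_closure A x -> A x \/ c_boundary A x.
Proof. intros H. destruct (classic (A x)); [now left|right; now split]. Qed.

(** * The two directions of the equivalence *)

Lemma chart_homeomorphism (Omega : cset) (psi phi : C -> C) :
  c_bounded Omega -> c_open Omega -> disc_chart Omega psi phi ->
  (forall x, c_boundary Omega x -> exists s, boundary_limit Omega phi x s) ->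
  (forall x y s, c_boundary Omega x -> c_boundary Omega y ->
     boundary_limit Omega phi x s -> boundary_limit Omega phi y s -> x = y) ->
  exists F : C -> C, (forall z, unit_disc z -> F z = psi z) /\
    c_homeomorphism closed_unit_disc (c_closure Omega) F.
Proof.
  intros Hb Ho Hch Hlim Hinj.
  (* On the circle [F z] is a boundary point at which [phi] tends to [z]:
     [boundary_point_clustering] provides one, and [Hinj] makes it unique. *)
  pose (F := fun z => if Rlt_dec (Cmod z) 1 then psi z else
     epsilon (inhabits (RtoC 0)) (fun x => c_boundary Omega x /\ boundary_limit Omega phi x z)).
  pose (G := fun w => if excluded_middle_informative (Omega w) then phi w else
     epsilon (inhabits (RtoC 0)) (fun s => boundary_limit Omega phi w s)).
  assert (HF1 : forall z, unit_disc z -> F z = psi z).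
  { intros z Hz. unfold F. destruct (Rlt_dec (Cmod z) 1); [reflexivity|easy]. }
  assert (HG1 : forall w, Omega w -> G w = phi w).
  { intros w Hw. unfold G. now destruct (excluded_middle_informative (Omega w)). }
  assert (HG2 : forall w, c_boundary Omega w ->
     Cmod (G w) = 1 /\ boundary_limit Omega phi w (G w)).
  { intros w Hw. assert (L : boundary_limit Omega phi w (G w)).
    { unfold G. destruct (excluded_middle_informative (Omega w)) as [K|_].
      - now destruct (proj2 Hw).
      - apply epsilon_spec. now apply Hlim. }
    split; [|assumption]. apply (clusters_Cmod Omega psi phi w); [assumption|apply Hw|].
    apply boundary_limit_clusters; [apply Hw|assumption]. }
  assert (HF2 : forall z, Cmod z = 1 -> c_boundary Omega (F z) /\
     boundary_limit Omega phi (F z) z).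
  { intros z Hz. unfold F. destruct (Rlt_dec (Cmod z) 1) as [K|_]; [lra|].
    apply epsilon_spec.
    destruct (boundary_point_clustering Omega psi phi z Hch Hb Hz) as [x [Hx Hcl]].
    exists x. split; [assumption|]. destruct (Hlim x Hx) as [s Hs].
    now rewrite <- (boundary_limit_unique _ _ _ _ _ Hs Hcl). }
  assert (Hcd : forall z, closed_unit_disc z -> unit_disc z \/ Cmod z = 1).
  { intros z [Hz|Hz]; [now left|now right]. }
  destruct Hch as [Hpsi [Hphi _]].
  assert (HGF : forall z, closed_unit_disc z -> G (F z) = z).
  { intros z Hz. destruct (Hcd z Hz) as [D|E].
    - rewrite HF1 by assumption. destruct (Hpsi z D) as [Hw [E _]]. now rewrite HG1.
    - destruct (HF2 z E) as [Hx L]. destruct (HG2 _ Hx) as [_ L'].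
      apply (boundary_limit_unique Omega phi (F z)); [assumption|].
      apply boundary_limit_clusters; [apply Hx|assumption]. }
  assert (HGd : forall w, c_closure Omega w -> closed_unit_disc (G w)).
  { intros w Hw. unfold closed_unit_disc. destruct (c_closure_cases _ _ Hw) as [H|H].
    - rewrite HG1 by assumption. left. now apply Hphi.
    - right. now apply HG2. }
  assert (HFG : forall w, c_closure Omega w -> F (G w) = w).
  { intros w Hw. destruct (c_closure_cases _ _ Hw) as [H|H].
    - rewrite HG1 by assumption. destruct (Hphi w H) as [D [E _]]. now rewrite HF1.
    - destruct (HG2 w H) as [E L]. destruct (HF2 (G w) E) as [H' L'].
      now apply (Hinj _ _ (G w)). }
  assert (HFc : forall z, closed_unit_disc z -> c_closure Omega (F z)).
  { intros z Hz. destruct (Hcd z Hz) as [D|E].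
    - rewrite HF1 by assumption. apply c_closure_subset. now apply Hpsi.
    - apply (HF2 z E). }
  assert (HGcont : c_continuous_on (c_closure Omega) G).
  { intros x Hx eps Heps. destruct (c_closure_cases _ _ Hx) as [H|H].
    - destruct (Hphi x H) as [_ [_ Hc]]. destruct (Hc eps Heps) as [d [Hd K]].
      destruct (Ho x H) as [r [Hr Hball]].
      exists (Rmin d r). split; [now apply Rmin_pos|]. intros w _ W.
      rewrite !HG1; try assumption.
      + apply K. eapply Rlt_le_trans; [exact W|apply Rmin_l].
      + apply Hball. eapply Rlt_le_trans; [exact W|apply Rmin_r].
    - destruct (HG2 x H) as [_ L]. destruct (L (eps / 2)) as [d [Hd K]]; [lra|].
      exists d. split; [assumption|]. intros w Hw W.
      (* The limit at [x] speaks of points of [Omega] only. A nearby [w], possibly on the boundary,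
         is replaced by some [w'] in [Omega] still within [d] of [x] and with [phi w'] close to
         [G w]. *)
      assert (Hwc : clusters Omega phi w (G w)).
      { destruct (c_closure_cases _ _ Hw) as [Hw'|Hw'].
        - intros e He. exists w. rewrite HG1, !cdist_refl by assumption. auto.
        - apply boundary_limit_clusters; [assumption|]. now apply HG2. }
      destruct (Hwc (Rmin (eps / 2) (d - cdist w x))) as [w' [Hw' [W1 W2]]].
      { apply Rmin_pos; lra. }
      assert (W3 := Rlt_le_trans _ _ _ W1 (Rmin_r _ _)).
      assert (W4 := Rlt_le_trans _ _ _ W2 (Rmin_l _ _)).
      specialize (K w' Hw').
      assert (T := cdist_triangle w' w x). specialize (K ltac:(lra)).
      assert (T' := cdist_triangle (G w) (phi w') (G x)).
      rewrite (cdist_sym (G w) (phi w')) in T'. lra. }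
  exists F. split; [assumption|]. exists G. repeat (split; [assumption|]).
  split; [|assumption].
  (* The inverse of a continuous bijection on a compact set is continuous: counterexamples
     accumulate at some [w0] with [G w0 = z], although they stay away from [F z = w0]. The bound
     [M + 1] covers the closure. *)
  intros z Hz eps Heps. apply NNPP. intros Hno. destruct Hb as [M HM].
  destruct (accumulation_point_eps (fun d w => c_closure Omega w /\
    cdist (G w) z < d /\ eps <= cdist w (F z)) (M + 1)) as [w0 Hw0].
  - intros d d' w Hdd [H1 [H2 H3]]. repeat split; try assumption. lra.
  - intros d Hd. apply NNPP. intros H. apply Hno. exists d. split; [assumption|].
    intros z' Hz' W. apply Rnot_le_lt. intros K. apply H. exists (F z').
    assert (Hc := HFc z' Hz'). rewrite HGF by assumption. repeat split; try assumption.
    destruct (Hc 1 Rlt_0_1) as [y [Hy Y]]. specialize (HM y Hy).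
    generalize (Cmod_triangle_inv (F z') y). rewrite cdist_sym. lra.
  - assert (Hw0c : c_closure Omega w0).
    { intros r Hr. destruct (Hw0 (r / 2)) as [w [[Hw _] W]]; [lra|].
      destruct (Hw (r / 2)) as [y [Hy Y]]; [lra|]. exists y. split; [assumption|].
      generalize (cdist_triangle y w w0). lra. }
    assert (E : G w0 = z).
    { apply cdist_small_eq. intros e He.
      destruct (HGcont w0 Hw0c (e / 2)) as [d [Hd K]]; [lra|].
      destruct (Hw0 (Rmin d (e / 2))) as [w [[Hw [W1 _]] W2]]; [apply Rmin_pos; lra|].
      specialize (K w Hw (Rlt_le_trans _ _ _ W2 (Rmin_l _ _))).
      assert (W3 := Rlt_le_trans _ _ _ W1 (Rmin_r _ _)).
      generalize (cdist_triangle (G w0) (G w) z). rewrite (cdist_sym (G w0) (G w)). lra. }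
    rewrite <- E, HFG in Hw0 by assumption.
    destruct (Hw0 eps Heps) as [w [[_ [_ W1]] W2]]. lra.
Qed.

Lemma homeomorphism_horospheres (Omega : cset) (psi phi F : C -> C) (x : C) (Rr : R) :
  disc_chart Omega psi phi -> (forall z, unit_disc z -> F z = psi z) ->
  c_homeomorphism closed_unit_disc (c_closure Omega) F ->
  c_boundary Omega x -> 0 < Rr ->
  (forall y, (c_closure (small_horosphere Omega (psi 0) x Rr) y /\ c_boundary Omega y)
     <-> y = x) /\
  (forall y, (c_closure (big_horosphere Omega (psi 0) x Rr) y /\ c_boundary Omega y)
     <-> y = x).
Proof.
  intros Hch HF [G [HFc [HGd [HGF [HFG [HFcont HGcont]]]]]] Hx HR.
  assert (Hch' := Hch). destruct Hch' as [Hpsi [Hphi _]].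
  assert (HGphi : forall w, Omega w -> G w = phi w).
  { intros w Hw. destruct (Hphi w Hw) as [D [E _]].
    rewrite <- E at 1. rewrite <- HF by assumption. apply HGF. left. exact D. }
  assert (HG1 : forall y, c_boundary Omega y -> Cmod (G y) = 1).
  { intros y [Hy1 Hy2]. destruct (HGd y Hy1) as [D|E]; [|assumption].
    exfalso. apply Hy2. rewrite <- (HFG y Hy1), HF by exact D. now apply Hpsi. }
  assert (Hlim : forall y, c_boundary Omega y -> boundary_limit Omega phi y (G y)).
  { intros y Hy eps Heps. destruct (HGcont y (proj1 Hy) eps Heps) as [d [Hd K]].
    exists d. split; [assumption|]. intros w Hw W. rewrite <- HGphi by assumption.
    apply K; [now apply c_closure_subset|assumption]. }
  pose (s := G x). assert (Hs1 : Cmod s = 1) by now apply HG1.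
  assert (Hsmall : c_closure (small_horosphere Omega (psi 0) x Rr) x).
  { intros r Hr.
    destruct (HFcont s (HGd x (proj1 Hx)) r Hr) as [d [Hd K]].
    unfold s in K at 2. rewrite HFG in K by apply Hx.
    (* The point [(1 - m) s] lies in the horodisc when [m^2 < Rr (2 m - m^2)]. The bounds by
       [Rr / 2] and [1 / 2] ensure this, and [d / 2] keeps the image close to [x]. *)
    pose (m := Rmin (d / 2) (Rmin (1 / 2) (Rr / 2))).
    assert (M1 : m <= d / 2) by apply Rmin_l.
    assert (M2 : m <= 1 / 2) by (eapply Rle_trans; [apply Rmin_r|apply Rmin_l]).
    assert (M3 : m <= Rr / 2) by (eapply Rle_trans; [apply Rmin_r|apply Rmin_r]).
    assert (M4 : 0 < m) by (repeat apply Rmin_pos; lra).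
    clearbody m.
    assert (Hmod : Cmod (RtoC (1 - m) * s)%C = 1 - m).
    { rewrite Cmod_mult, Cmod_R, Hs1, Rabs_pos_eq; lra. }
    assert (Hdist : cdist (RtoC (1 - m) * s)%C s = m).
    { unfold cdist. replace (RtoC (1 - m) * s - s)%C with (RtoC (- m) * s)%C
        by (rewrite RtoC_minus, RtoC_opp; ring).
      rewrite Cmod_mult, Cmod_R, Hs1, Rabs_left1; lra. }
    assert (D : unit_disc (RtoC (1 - m) * s)%C) by (unfold unit_disc; lra).
    exists (psi (RtoC (1 - m) * s)%C). split.
    - apply (small_horosphere_limit Omega psi phi x s); try assumption; [now apply Hlim|].
      rewrite Hmod, Hdist.
      assert (P : 0 < Rr * m) by now apply Rmult_lt_0_compat.
      assert (A : m * m <= m * (Rr / 2)) by (apply Rmult_le_compat_l; lra).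
      assert (B : Rr * m * m <= Rr * m * (1 / 2)) by (apply Rmult_le_compat_l; lra).
      replace (m ^ 2) with (m * m) by ring.
      replace (Rr * (1 - (1 - m) ^ 2)) with (2 * (Rr * m) - Rr * m * m) by ring. lra.
    - rewrite <- HF by assumption. apply K; [left; exact D|]. rewrite Hdist. lra. }
  assert (Hbig : forall y, c_closure (big_horosphere Omega (psi 0) x Rr) y ->
     c_boundary Omega y -> y = x).
  { intros y Hy Hyb. rewrite <- (HFG y (proj1 Hyb)), <- (HFG x (proj1 Hx)). f_equal.
    fold s. apply cdist_small_eq. intros e He.
    assert (Ht1 := HG1 y Hyb).
    (* A horodisc touches the circle only at its base point: if [phi w] is within [m] of [G y], then
       [1 - |phi w|^2 <= 2 m], so [|phi w - s|^2 < 2 Rr m <= e^2 / 4]. *)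
    pose (m := Rmin (e / 2) (e ^ 2 / (8 * Rr))).
    assert (He2 : 0 < e ^ 2) by now apply pow_lt.
    assert (M1 : m <= e / 2) by apply Rmin_l.
    assert (M2 : m * (8 * Rr) <= e ^ 2).
    { apply Rle_trans with (e ^ 2 / (8 * Rr) * (8 * Rr)).
      - apply Rmult_le_compat_r; [lra|apply Rmin_r].
      - right. field. lra. }
    assert (M4 : 0 < m) by (apply Rmin_pos; [lra|apply Rdiv_lt_0_compat; lra]).
    clearbody m.
    destruct (Hlim y Hyb m M4) as [d [Hd K]].
    destruct (Hy d Hd) as [w [Hw W]]. assert (HwO : Omega w) by apply Hw.
    specialize (K w HwO W). destruct (Hphi w HwO) as [D [E _]].
    rewrite <- E in Hw.
    apply (big_horosphere_limit Omega psi phi x s) in Hw; try assumption; [|now apply Hlim].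
    unfold unit_disc in D. assert (D0 := Cmod_ge_0 (phi w)).
    assert (T1 := Cmod_triangle_inv (G y) (phi w)). rewrite cdist_sym in T1.
    assert (T2 := cdist_triangle (G y) (phi w) s). rewrite (cdist_sym (G y) (phi w)) in T2.
    assert (B1 : 1 - Cmod (phi w) ^ 2 <= 2 * m) by nra.
    assert (B2 : cdist (phi w) s ^ 2 < e ^ 2 / 4).
    { apply Rlt_le_trans with (1 := Hw).
      apply Rle_trans with (Rr * (2 * m)); [apply Rmult_le_compat_l; lra|lra]. }
    assert (B3 : cdist (phi w) s < e / 2).
    { apply Rnot_le_lt. intros Q.
      assert ((e / 2) ^ 2 <= cdist (phi w) s ^ 2) by (apply pow_incr; lra). lra. }
    lra. }
  (* With this inclusion, [Hsmall] for the small and [Hbig] for the big horosphere settle all four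
     implications. *)
  assert (Hincl : forall y, c_closure (small_horosphere Omega (psi 0) x Rr) y ->
     c_closure (big_horosphere Omega (psi 0) x Rr) y).
  { intros y Hy r Hr. destruct (Hy r Hr) as [w [Hw W]]. exists w. split; [|assumption].
    apply small_sub_big_horosphere; [apply Hx|assumption]. }
  split; intros y; split.
  - intros [H1 H2]. apply Hbig; auto.
  - intros ->. auto.
  - intros [H1 H2]. apply Hbig; auto.
  - intros ->. auto.
Qed.

Lemma cluster_unique_of_small_horospheres (Omega : cset) (psi phi : C -> C) (x s t : C) :
  disc_chart Omega psi phi ->
  (forall Rr, 0 < Rr -> exists z, small_horosphere Omega (psi 0) x Rr z) ->
  clusters Omega phi x s -> clusters Omega phi x t -> t = s.
Proof.
  intros Hch Hne Hs Ht. apply NNPP. intros Hst.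
  assert (Hd : 0 < cdist t s).
  { apply Rnot_le_lt. intros K. apply Hst. now apply cdist_eq_0. }
  set (d := cdist t s) in *.
  (* This parameter puts [phi w] within [d / 4] of both [s] and [t], so that their distance [d]
     would be at most [d / 2]. *)
  destruct (Hne (d ^ 2 / 16)) as [w Hw]; [apply Rdiv_lt_0_compat; [now apply pow_lt|lra]|].
  assert (HR : 0 < d ^ 2 / 16) by (apply Rdiv_lt_0_compat; [now apply pow_lt|lra]).
  destruct (proj1 (proj2 Hch) w (proj1 Hw)) as [D [E _]].
  rewrite <- E in Hw.
  assert (K : forall u, clusters Omega phi x u -> cdist (phi w) u <= d / 4).
  { intros u Hu.
    assert (B := small_horosphere_clusters _ _ _ _ _ _ _ Hch HR D Hu Hw).
    apply Rnot_lt_le. intros Q.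
    assert ((d / 4) ^ 2 < cdist (phi w) u ^ 2) by nra.
    assert (P := pow2_ge_0 (Cmod (phi w))).
    assert (d ^ 2 / 16 * (1 - Cmod (phi w) ^ 2) <= d ^ 2 / 16 * 1)
      by (apply Rmult_le_compat_l; lra).
    lra. }
  assert (K1 := K s Hs). assert (K2 := K t Ht).
  assert (T := cdist_triangle t (phi w) s). rewrite (cdist_sym t (phi w)) in T. fold d in T. lra.
Qed.

Theorem theorem1p1 (Omega : cset) (psi : C -> C) :
  c_bounded Omega ->
  c_simply_connected Omega ->
  biholomorphism unit_disc Omega psi ->
  let o := psi (RtoC 0) in
  (forall x Rr, c_boundary Omega x -> 0 < Rr ->
     (forall y, (c_closure (small_horosphere Omega o x Rr) y /\ c_boundary Omega y)
                <-> y = x) /\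
     (forall y, (c_closure (big_horosphere Omega o x Rr) y /\ c_boundary Omega y)
                <-> y = x))
  <->
  (exists F : C -> C, (forall z, unit_disc z -> F z = psi z) /\
     c_homeomorphism closed_unit_disc (c_closure Omega) F).
Proof.
  intros Hb [[_ [Ho _]] _] Hbi o.
  destruct (biholomorphism_disc_chart Omega psi Hbi) as [phi Hch].
  split.
  2:{ intros [F [HF Hhom]] x Rr Hx HR.
      now apply (homeomorphism_horospheres Omega psi phi F). }
  intros H.
  (* Existence of limits uses (i) only through this: [x] lies in the closure of the small
     horosphere, which is therefore nonempty. *)
  assert (Hne : forall x, c_boundary Omega x -> forall Rr, 0 < Rr ->
     exists z, small_horosphere Omega o x Rr z).
  { intros x Hx Rr HR. destruct (H x Rr Hx HR) as [H1 _].
    destruct (proj2 (H1 x) eq_refl) as [Hcl _].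
    destruct (Hcl 1 Rlt_0_1) as [z [Hz _]]. now exists z. }
  apply (chart_homeomorphism Omega psi phi); try assumption.
  - intros x Hx. destruct (clusters_inhabited Omega psi phi x Hch (proj1 Hx)) as [s Hs].
    exists s. apply (boundary_limit_of_unique_cluster Omega psi); [assumption|].
    intros t Ht. now apply (cluster_unique_of_small_horospheres Omega psi phi x s t Hch (Hne x Hx)).
  - (* The big horospheres at [x] and [y] are both the image of the horodisc at [s]. *)
    intros x y s Hx Hy Lx Ly.
    assert (Hs1 : Cmod s = 1).
    { apply (clusters_Cmod Omega psi phi x); [assumption|apply Hx|].
      apply boundary_limit_clusters; [apply Hx|assumption]. }
    destruct (H x 1 Hx Rlt_0_1) as [_ Hbx]. destruct (H y 1 Hy Rlt_0_1) as [_ Hby].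
    apply Hby. split; [|assumption].
    destruct (proj2 (Hbx x) eq_refl) as [Hcl _].
    intros r Hr. destruct (Hcl r Hr) as [w [Hw W]]. exists w. split; [|assumption].
    destruct (proj1 (proj2 Hch) w (proj1 Hw)) as [D [E _]].
    rewrite <- E in Hw |- *.
    apply small_sub_big_horosphere; [apply Hy|].
    apply (small_horosphere_limit Omega psi phi y s); try assumption; [lra|].
    apply (big_horosphere_limit Omega psi phi x s); try assumption. lra.
Qed.
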